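(* For any $\varepsilon>0$ there is $n_0$ so that the following holds for all $n>n_0$. Suppose $G$ is an $n$-vertex graph with minimum degree $\delta(G)\geq (1+\varepsilon)\sqrt{\tfrac{n\log n}{2}}$. Let $F\sim G_{n,2}$ be a random $2$-regular graph on the same vertex set as $G$. Then with high probability $G\cup F$ is Hamiltonian.
   Context: Graphs are finite and simple; $\log$ is the natural logarithm. $G_{n,2}$ denotes the uniform distribution on all simple $2$-regular graphs on the given labelled $n$-element vertex set (equivalently, the cycle graph of a uniformly random permutation conditioned on all cycles having length at least three). $G\cup F$ is the graph on the common vertex set whose edge set is $E(G)\cup E(F)$. A graph is Hamiltonian if it contains a cycle through all of its vertices. ''With high probability'' means with probability $1-o(1)$ as $n\to\infty$, where (for fixed $\varepsilon$) the $o(1)$ term is uniform over all graphs $G$ satisfying the hypothesis; the only randomness is in $F$. *)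

(* Defs.v *)
From HB Require Import structures.
From mathcomp Require Import all_boot all_order all_algebra.
From mathcomp Require Import all_classical all_reals all_analysis.
Set Implicit Arguments.
Unset Strict Implicit.
Unset Printing Implicit Defensive.
Import Order.TTheory GRing.Theory Num.Theory.
Import numFieldNormedType.Exports.
Local Open Scope ring_scope.

Record sgraph (V : finType) := SGraph {
  edges :> {set {set V}};
  edges_card2 : [forall e in edges, #|e| == 2%N]
}.

HB.instance Definition _ (V : finType) := [isSub for @edges V].
HB.instance Definition _ (V : finType) := [Finite of sgraph V by <:].

Section Graphs.
Variable V : finType.
Implicit Types G F : sgraph V.

Definition adj G : rel V := fun u v => [set u; v] \in edges G.

Definition degree G (v : V) : nat := #|[set u | adj G v u]|.

(* Degrees are at most #|V|, so the neutral element is harmless; for empty V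
   this is 0. *)
Definition min_degree G : nat := \big[minn/#|V|]_(v : V) degree G v.

Lemma gunion_card2 G F : [forall e in edges G :|: edges F, #|e| == 2%N].
Proof.
apply/forall_inP => e; rewrite inE => /orP[].
  exact: (forall_inP (edges_card2 G)).
exact: (forall_inP (edges_card2 F)).
Qed.

Definition gunion G F : sgraph V := SGraph (gunion_card2 G F).

Definition regular_graphs (d : nat) : {set sgraph V} :=
  [set F | [forall v, degree F v == d]].

Definition is_cycle G (s : seq V) : bool :=
  [&& (2 < size s)%N, uniq s & cycle (adj G) s].

(* Quantifying over #|V|-tuples keeps this boolean; hamiltonianP shows that the
   restriction on the length loses nothing. *)
Definition hamiltonian G : bool :=
  [exists s : #|V|.-tuple V, is_cycle G s && [forall v, v \in s]].

Lemma hamiltonianP G :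
  reflect (exists s : seq V, is_cycle G s /\ forall v, v \in s)
          (hamiltonian G).
Proof.
apply: (iffP existsP) => [[s /andP[cs /forallP sV]]|[s [cs sV]]].
  by exists s.
have sz : size s == #|V|.
  have /and3P[_ us _] := cs.
  by rewrite -(card_uniqP us); apply/eqP/eq_card => v; rewrite sV.
by exists (Tuple sz); rewrite cs /=; apply/forallP => v; exact: sV.
Qed.

End Graphs.

(* Probability that a uniformly random element of S lies in A; it is 0 when S
   is empty. *)
Definition unif_prob (R : realType) (T : finType) (S A : {set T}) : R :=
  #|S :&: A|%:R / #|S|%:R.

(* Main.v *)
Require Import Defs.
From HB Require Import structures.
From mathcomp Require Import all_boot all_order all_fingroup all_algebra.
From mathcomp Require Import all_classical all_reals all_analysis.
From mathcomp Require Import fintype finset.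
From mathcomp Require Import ring lra zify.
Set Implicit Arguments.
Unset Strict Implicit.
Unset Printing Implicit Defensive.
Import Order.TTheory GRing.Theory Num.Theory.
Import numFieldNormedType.Exports.
Local Open Scope ring_scope.

(** Orient the cycles of the 2-regular graph F, so that F is the graph of a
    permutation p. If x and u lie on different cycles of p, and G has the edges
    from x to p u and from u to p x, then multiplying p by the transposition of
    x and u splices the two cycles into one, along these two edges of G. If such
    mergers can be performed one after the other until a single cycle is left,
    then the union of G and F is Hamiltonian ([hamiltonian_merged]).

    How many mergers are needed? A 2-regular graph with c cycles has 2^c
    orientations, so F is a random permutation with weight 2^-c conditioned on
    having no cycle of length one or two. Comparing generating functions of the
    number of cycles gives that F has at most (1/2 + eps/8) log n cycles with
    high probability ([many_cycles_le]).

    Are there enough mergers? The distribution of F is invariant under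
    relabelling, so the cycle type of F can be fixed and the vertices of G be
    placed on the cycles by a uniform permutation. Let k be about the minimum
    degree of G. Fix one edge from x to p x on a cycle. A vertex u serves for a
    merger if it is placed in the neighbourhood of p x while p u is placed in
    the neighbourhood of x; on average there are about k^2 / n such u, which is
    at least (1 + eps) (log n) / 2. This exceeds the number of cycles by a
    constant factor, and the lower tail is polynomially small
    ([few_absorbers]), so that every cycle can choose a private u greedily, and
    a union bound over the O(log n) cycles suffices.

    The vertices u must lie on cycles that are not waiting to be merged
    themselves. Hence the cycles are split into short ones and long ones, of at
    least about k / 4 vertices. Short cycles contain o(n) vertices altogether,
    and restricting u to long cycles costs a factor 1 - o(1). The long cycles
    are first merged with the largest one: in each of them, and in the largest
    one, about k / 8 edges are reserved for this purpose, and among these two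
    sets of edges a suitable pair exists except with polynomially small
    probability ([cross_edges_fail]). The reserved edges are withheld from the
    short cycles, so the mergers do not disturb each other
    ([linked_merged]). *)

(** * Preliminaries *)

Lemma le_of_eq (R : numDomainType) (x y : R) : x = y -> x <= y.
Proof. by move->. Qed.

Lemma ler_sum_subset (R : numDomainType) (I : finType) (P Q : pred I) (F : I -> R) :
    (forall i, P i -> Q i) -> (forall i, Q i -> 0 <= F i) ->
  \sum_(i | P i) F i <= \sum_(i | Q i) F i.
Proof.
move=> PQ F0; rewrite [leRHS](bigID P) /=.
rewrite (eq_bigl P) => [|i]; last by rewrite andbC; case: (boolP (P i)) => // /PQ.
by rewrite lerDl sumr_ge0 // => i /andP[/F0].
Qed.

Lemma exists_subset_card (V : finType) (A : {set V}) m : (m <= #|A|)%N ->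
  exists2 B : {set V}, B \subset A & #|B| = m.
Proof.
move=> mA; exists [set x in take m (enum A)].
  by apply/subsetP => x; rewrite inE => /mem_take; rewrite mem_enum.
rewrite cardsE (card_uniqP _) ?take_uniq ?enum_uniq // size_take -cardE.
by move: mA; rewrite leq_eqVlt => /orP[/eqP->|->] //; rewrite ltnn.
Qed.

(** * Exposing a uniform permutation; merging cycles *)

Section FreshExposure.
Variables (V : finType) (R : nzRingType).

(** Given the values of s on Z, the value s p is uniform outside the image of Z:
    precomposing s with the transposition of p and another point r outside Z is
    a bijection that keeps the values on Z and puts s r in place of s p. All
    probability estimates below iterate this identity. *)
Lemma sum_fresh_image (Z : {set V}) (p : V) (h : {perm V} -> V -> R) :
    p \notin Z ->
    (forall s s' : {perm V}, {in Z, s =1 s'} -> h s =1 h s') ->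
  (\sum_(s : {perm V}) h s (s p)) *+ (#|V| - #|Z|)
    = \sum_(s : {perm V}) \sum_(w | w \notin s @: Z) h s w.
Proof.
move=> pZ hZ.
have -> : \sum_(s : {perm V}) \sum_(w | w \notin s @: Z) h s w
          = \sum_(s : {perm V}) \sum_(r | r \notin Z) h s (s r).
  apply: eq_bigr => s _; rewrite (reindex_inj (@perm_inj _ s)).
  by apply: eq_bigl => r; rewrite mem_imset //; apply: perm_inj.
have -> : (#|V| - #|Z| = #|~: Z|)%N by rewrite (cardsCs (~: Z)) setCK.
rewrite exchange_big /= -sumr_const; apply: eq_big => [r|r]; rewrite inE // => rZ.
rewrite [RHS](reindex_inj (mulgI (tperm p r))) /=.
apply: eq_bigr => s _; rewrite permM tpermR; symmetry; apply: hZ => z zZ.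
rewrite permM tpermD //; first by apply: contraNneq pZ => ->.
by apply: contraNneq rZ => ->.
Qed.

End FreshExposure.

Section Merging.
Variables (V : finType) (g : rel V) (pi : {perm V}).

(** A cycle that no merger has touched is still a cycle. *)
Lemma porbit_agree (rho : {perm V}) x :
  {in porbit pi x, rho =1 pi} -> porbit rho x = porbit pi x.
Proof.
move=> agr; have pw i : (rho ^+ i)%g x = (pi ^+ i)%g x.
  by elim: i => [|i IH]; rewrite ?expg0 // !expgSr !permM IH agr ?mem_porbit.
by apply/setP => y; apply/porbitP/porbitP => -[i ->]; exists i.
Qed.

(** The state after k mergers. The set D collects the points whose successor has
    been changed; outside D the oriented cycles of pi are intact. *)
Definition merged (D : {set V}) (k : nat) :=
  exists rho : {perm V},
    [/\ forall v, v \notin D -> rho v = pi v,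
        forall v, v \in D -> g v (rho v)
      & (#|porbits rho| + k)%N = #|porbits pi|].

Lemma merged0 : merged set0 0.
Proof. by exists pi; split=> // [v|]; rewrite ?inE ?addn0. Qed.

(** The cycle of x is untouched, hence still a cycle of rho, and it does not
    contain u; so the transposition joins two cycles rather than splitting
    one. *)
Lemma mergedS D k x u :
    merged D k -> [disjoint porbit pi x & D] -> u \notin D ->
    u \notin porbit pi x -> g x (pi u) -> g u (pi x) ->
  merged (x |: (u |: D)) k.+1.
Proof.
case=> rho [rhoN rhoD ck] dis uD ux gxu gux.
have agr : {in porbit pi x, rho =1 pi}.
  by move=> y yx; apply: rhoN; rewrite (disjointFr dis yx).
have xD : x \notin D by rewrite (disjointFr dis (porbit_id pi x)).
have xu : x != u by apply: contraNneq ux => <-; apply: porbit_id.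
exists (tperm x u * rho)%g; split.
- move=> v; rewrite !inE !negb_or => /and3P[vx vu vD].
  by rewrite permM tpermD 1?eq_sym // rhoN.
- move=> v; rewrite !inE permM => /or3P[/eqP->|/eqP->|vD].
  + by rewrite tpermL rhoN.
  + by rewrite tpermR rhoN.
  have vx : v != x by apply: contraTneq vD => ->.
  have vu : v != u by apply: contraTneq vD => ->.
  by rewrite tpermD 1?eq_sym // rhoD.
have := porbits_mul_tperm rho x u; rewrite /= porbit_sym (porbit_agree agr) ux xu -ck /=.
by rewrite addn1 !addnS addn0 => -[<-]; rewrite addSn.
Qed.

End Merging.

(** * Counting permutations by their number of cycles *)

Section CycleCounts.
Variable V : finType.
Implicit Types (s p : {perm V}) (S : {set V}).

Lemma tperm_other (x y z : V) : z != x -> z != y -> tperm x y z = z.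
Proof. by rewrite ![z == _]eq_sym; apply: tpermD. Qed.

Lemma perm_on_fix S s v : perm_on S s -> v \notin S -> s v = v.
Proof. by move=> sS vS; apply: out_perm sS vS. Qed.

Lemma card_porbits1 : #|porbits (1%g : {perm V})| = #|V|.
Proof.
rewrite card_imset // => x y /eqP; rewrite eq_porbit_mem => /porbitP[i ->].
by rewrite expg1n perm1.
Qed.

(** Since s fixes v, the product [tperm v a * s] is s with v inserted between a
    and s a. *)
Lemma card_porbits_insert s v a :
  s v = v -> a != v -> #|porbits s| = #|porbits (tperm v a * s)%g|.+1.
Proof.
move=> sv av; have := porbits_mul_tperm s v a; rewrite /= eq_sym av porbit_sym.
have -> : a \notin porbit s v.
  apply/porbitP => -[i ai]; case/eqP: av; rewrite ai.
  by elim: i {ai} => [|i IH]; rewrite ?expg0 ?perm1 // expgSr permM IH.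
by rewrite addn1 !addnS addn0 => -[->].
Qed.

(** Every permutation of S arises exactly once by inserting v into a permutation
    of the remaining points; a is the predecessor of v. *)
Lemma perm_on_insert S s v a : v \in S -> a \in S ->
  perm_on S (tperm v a * s)%g && ((tperm v a * s)%g a == v)
    = perm_on (S :\ v) s.
Proof.
move=> vS aS; rewrite permM tpermR.
apply/andP/subsetP => [[/subsetP sS /eqP sv] x|sS].
  rewrite !inE => sx; have xv : x != v by apply: contraNneq sx => ->; rewrite sv.
  rewrite xv /=; case: (eqVneq x a) => [-> //|xa]; apply: sS.
  by rewrite inE permM tperm_other.
have sv : s v = v.
  apply/eqP/negPn/negP => sv; have /sS : v \in [pred x | s x != x] by [].
  by rewrite !inE eqxx.
split; last by rewrite sv.
apply/subsetP => x; rewrite inE permM.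
case: (eqVneq x v) => [-> //|xv]; case: (eqVneq x a) => [-> //|xa].
rewrite tperm_other // => sx.
have /sS : x \in [pred x | s x != x] by [].
by rewrite inE => /andP[].
Qed.

Lemma sum_perm_on_insert (R : nmodType) S v (f : {perm V} -> R) : v \in S ->
  \sum_(p : {perm V} | perm_on S p) f p
    = \sum_(a in S) \sum_(s : {perm V} | perm_on (S :\ v) s) f (tperm v a * s)%g.
Proof.
move=> vS.
rewrite (partition_big (fun p : {perm V} => (p^-1)%g v) (mem S)) /=; last first.
  move=> p pS; rewrite -[_ \in S](perm_closed _ pS).
  by rewrite permKV.
apply: eq_bigr => a aS.
rewrite (reindex_inj (mulgI (tperm v a))) /=; apply: eq_bigl => s.
rewrite -(perm_on_insert s vS aS); congr (_ && _).
by rewrite (can2_eq (permKV _) (permK _)) eq_sym.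
Qed.

(** The point inserted after i others either opens a cycle, with weight y, or is
    placed behind one of the i points, without a new cycle. *)
Lemma sum_perm_porbits (R : fieldType) (y : R) : y != 0 ->
  \sum_(s : {perm V}) y ^+ #|porbits s| = \prod_(i < #|V|) (y + i%:R).
Proof.
move=> y0.
suff gen k S : #|S| = k ->
    \sum_(s : {perm V} | perm_on S s) y ^+ #|porbits s|
      = y ^+ (#|V| - k) * \prod_(i < k) (y + i%:R).
  have := gen _ _ (cardsT V); rewrite subnn expr0 mul1r => <-.
  by apply: eq_bigl => s; apply/esym/subsetP => x; rewrite inE.
elim: k S => [|k IH] S cS.
  rewrite big_ord0 mulr1 subn0 -card_porbits1; apply: big_pred1 => s /=.
  move/eqP: cS; rewrite cards_eq0 => /eqP ->.
  apply/idP/eqP => [s0|->]; last exact: perm_on1.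
  by apply/permP => x; rewrite perm1 (perm_on_fix s0) // inE.
have [v vS] : exists v, v \in S by apply/card_gt0P; rewrite cS.
have cS' : #|S :\ v| = k by move: cS; rewrite (cardsD1 v) vS => -[].
have kn : (k < #|V|)%N by rewrite -cS max_card.
rewrite (sum_perm_on_insert _ vS) (big_setD1 v vS) /=.
rewrite [X in X + _](eq_bigr (fun s => y ^+ #|porbits s|)); last first.
  by move=> s _; rewrite tperm1 mul1g.
have -> : \sum_(a in S :\ v) \sum_(s : {perm V} | perm_on (S :\ v) s)
      y ^+ #|porbits (tperm v a * s)%g|
    = \sum_(a in S :\ v) \sum_(s : {perm V} | perm_on (S :\ v) s)
        y ^+ #|porbits s| / y.
  apply: eq_bigr => a; rewrite inE in_set1 => /andP[av _]; apply: eq_bigr => s sS.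
  by rewrite (card_porbits_insert (perm_on_fix sS _) av) ?setD11 // exprSr mulfK.
rewrite sumr_const cS' -mulr_suml IH // big_ord_recr /=.
rewrite -(subnSK kn) exprSr.
by field.
Qed.

Definition no_short_cycle S (p : {perm V}) :=
  perm_on S p && [forall v in S, (p v != v) && (p (p v) != v)].

Lemma no_short_cycle_insert S s v a : v \in S -> a \in S :\ v ->
  no_short_cycle (S :\ v) s -> no_short_cycle S (tperm v a * s)%g.
Proof.
move=> vS; rewrite !inE => /andP[av aS] /andP[sS /forall_inP s3].
have := perm_on_insert s vS aS; rewrite sS => /andP[pS _].
rewrite /no_short_cycle pS /=; apply/forall_inP => x xS.
have sv : s v = v by rewrite (perm_on_fix sS) // setD11.
have sNv z : z != v -> s z != v by rewrite -{2}sv (inj_eq perm_inj).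
have s3' z : z != v -> z \in S -> (s z != z) && (s (s z) != z).
  by move=> zv zS; apply: s3; rewrite !inE zv.
rewrite !permM; case: (eqVneq x v) => [->|xv].
  rewrite tpermL sNv //= tperm_other ?sNv //.
  by case/andP: (s3' _ av aS).
case: (eqVneq x a) => [->|xa].
  by rewrite tpermR sv tpermL eq_sym av /=; case/andP: (s3' _ av aS).
rewrite (tperm_other xv xa); case/andP: (s3' _ xv xS) => -> ssx /=.
case: (eqVneq (s x) a) => [->|sxa]; first by rewrite tpermR sv eq_sym.
by rewrite tperm_other ?sNv.
Qed.

(** The product inserts the triangle that maps v to b, b to a and a to v. The
    second and the fourth conclusion make these permutations differ from the
    ones of [no_short_cycle_insert], and for different b from each other. *)
Lemma no_short_cycle_triangle S s v a b :
    v \in S -> a \in S :\ v -> b \in S :\ v :\ a ->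
    no_short_cycle (S :\ v :\ a :\ b) s ->
  [/\ no_short_cycle S (tperm v a * (tperm a b * s))%g,
      ~~ no_short_cycle (S :\ v) (tperm a b * s)%g,
      perm_on (S :\ v) (tperm a b * s)%g
    & (tperm a b * s)%g a = b].
Proof.
move=> vS aS' bS' /andP[sS /forall_inP s3].
have [av aS] : a != v /\ a \in S by move: aS'; rewrite !inE => /andP[].
have [ba bv bS] : [/\ b != a, b != v & b \in S].
  by move: bS'; rewrite !inE => /and3P[].
have [va vb ab] : [/\ v != a, v != b & a != b] by split; rewrite eq_sym.
have sS2 : perm_on (S :\ v :\ a) s.
  by apply: subset_trans sS _; apply: subsetDl.
have s2 : perm_on (S :\ v) (tperm a b * s)%g.
  have := perm_on_insert s aS' (subsetP (subsetDl _ _) _ bS').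
  by rewrite sS2 => /andP[].
have pS : perm_on S (tperm v a * (tperm a b * s))%g.
  by have := perm_on_insert (tperm a b * s)%g vS aS; rewrite s2 => /andP[].
have [sv sa sb] : [/\ s v = v, s a = a & s b = b].
  by split; apply: perm_on_fix sS _; rewrite !inE ?eqxx ?andbF.
split=> //; last by rewrite permM tpermL.
- rewrite /no_short_cycle pS /=; apply/forall_inP => x xS; rewrite !permM.
  case: (eqVneq x v) => [->|xv].
    by rewrite tpermL tpermL sb bv (tperm_other bv ba) tpermR sa.
  case: (eqVneq x a) => [->|xa].
    by rewrite tpermR (tperm_other va vb) sv va /= tpermL tpermL sb.
  case: (eqVneq x b) => [->|xb].
    by rewrite (tperm_other bv ba) tpermR sa ab /= tpermR (tperm_other va vb) sv.
  have xS3 : x \in S :\ v :\ a :\ b by rewrite !inE xa xb xv.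
  have sx3 : s x \in S :\ v :\ a :\ b by rewrite (perm_closed _ sS).
  have [xv' xa' xb'] : [/\ s x != v, s x != a & s x != b].
    by move: sx3; rewrite !inE => /and4P[-> -> ->].
  rewrite (tperm_other xv xa) (tperm_other xa xb).
  rewrite (tperm_other xv' xa') (tperm_other xa' xb').
  exact: s3.
- apply/negP => /andP[_ /forall_inP /(_ a aS')].
  by rewrite !permM tpermL sb tpermR sa eqxx andbF.
Qed.

End CycleCounts.

Section NoShortCycleWeight.
Variables (V : finType) (R : realFieldType).
Implicit Types (s p : {perm V}) (S : {set V}).

(** With S the whole type, this is the number of 2-regular graphs, because a
    graph with c cycles has 2^c orientations. Each point outside S is a fixed
    point and contributes a further factor 1/2. *)
Definition nsc_weight S : R :=
  \sum_(s | no_short_cycle S s) 2^-1 ^+ #|porbits s|.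

(** Either v lies on a cycle of length at least four, and removing v leaves a
    permutation without short cycles, or v lies on a triangle, which can be
    removed altogether. Every insertion lowers the number of orbits by one,
    whence the factors 2 and 4 = 2 * 2. *)
Lemma nsc_weight_rec S v : v \in S ->
  \sum_(a in S :\ v) (2 * nsc_weight (S :\ v)
      + \sum_(b in S :\ v :\ a) 4 * nsc_weight (S :\ v :\ a :\ b))
  <= nsc_weight S.
Proof.
move=> vS; pose F p : R := if no_short_cycle S p then 2^-1 ^+ #|porbits p| else 0.
have F0 p : 0 <= F p by rewrite /F; case: ifP => // _; rewrite exprn_ge0 // invr_ge0.
have -> : nsc_weight S = \sum_(p : {perm V} | perm_on S p) F p.
  by rewrite -big_mkcondr; apply: eq_bigl => p; rewrite /no_short_cycle andbA andbb.
rewrite (sum_perm_on_insert _ vS) [leRHS](big_setD1 v vS) /=.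
rewrite -[leLHS]add0r lerD ?sumr_ge0 //; apply: ler_sum => a aS.
have av : a != v by move: aS; rewrite !inE => /andP[].
rewrite [leRHS](bigID (no_short_cycle (S :\ v))) /=; apply: lerD.
  rewrite /nsc_weight mulr_sumr; apply: le_trans (ler_sum_subset _ _) => [||//].
  - apply: ler_sum => s sS; rewrite /F (no_short_cycle_insert vS aS sS).
    have [sS' _] := andP sS.
    rewrite (card_porbits_insert (perm_on_fix sS' _) av) ?setD11 //.
    by rewrite exprS; move: (_ ^+ _) => X; lra.
  - by move=> s sS; rewrite sS andbT; case/andP: sS.
rewrite [leRHS](partition_big (fun s : {perm V} => s a) predT) //=.
apply: le_trans (ler_sum_subset (P := mem (S :\ v :\ a)) _ _) => //; last first.
  by move=> b _; apply: sumr_ge0.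
apply: ler_sum => b bS; rewrite /nsc_weight mulr_sumr.
rewrite [leRHS](reindex_inj (mulgI (tperm a b))) /=.
apply: le_trans (ler_sum_subset (P := no_short_cycle (S :\ v :\ a :\ b)) _ _);
  [apply: ler_sum|..] => // s sS.
- have [H1 _ H2 _] := no_short_cycle_triangle vS aS bS sS; rewrite /F H1.
  have [sS' _] := andP sS.
  have ba : b != a by move: bS; rewrite !inE => /andP[].
  have sa : s a = a by apply: perm_on_fix sS' _; rewrite !inE eqxx andbF.
  rewrite (card_porbits_insert sa ba).
  rewrite (card_porbits_insert (perm_on_fix H2 _) av) ?setD11 //.
  by rewrite !exprS; move: (_ ^+ _) => X; lra.
- by have [_ -> -> ->] := no_short_cycle_triangle vS aS bS sS; rewrite eqxx.
Qed.

(** The recursion r(n) = (n-1) r(n-1) + (n-1)(n-2)/2 r(n-3) for the number of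
    labelled 2-regular graphs, with the values at 0, 1 and 2. *)
Fixpoint ewens_lower (k : nat) : R :=
  match k with
  | 0 => 1
  | 1 | 2 => 0
  | ((k0.+1 as k1).+1 as k2).+1 =>
      k2%:R * ewens_lower k2 + k2%:R * k1%:R / 2 * ewens_lower k0
  end.

(** The product P(n) satisfies P(n) = (n - 1/2) P(n-1) and
    P(n-1) <= (n-1)(n-2) P(n-3), so the recursion preserves the lower bound; the
    constant is dictated by the initial values at 3, 4 and 5. *)
Lemma ewens_lower_le k :
  2 / 5 * \prod_(i < k.+3) (2^-1 + i%:R) <= ewens_lower k.+3.
Proof.
have big k' : \prod_(i < k'.+3) (2^-1 + i%:R)
    = \prod_(i < k') (2^-1 + i%:R) * (2^-1 + k'%:R) * (2^-1 + k'.+1%:R)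
      * (2^-1 + k'.+2%:R) :> R.
  by rewrite !big_ord_recr.
elim/ltn_ind: k => -[|[|[|k]]] IH.
- rewrite !big_ord_recr big_ord0 /=; lra.
- rewrite !big_ord_recr big_ord0 /=; lra.
- rewrite !big_ord_recr big_ord0 /=; lra.
have := IH k.+2 (ltnSn _); have := IH k ltac:(by rewrite -addn3 -addn1 leq_add2l).
set E := ewens_lower; move=> I1 I2.
have -> : E k.+3.+3 = k.+3.+2%:R * E k.+3.+2 + k.+3.+2%:R * k.+3.+1%:R / 2 * E k.+3.
  by [].
have J1 : 0 <= k.+3.+2%:R :> R by [].
have J2 : 0 <= k.+3.+2%:R * k.+3.+1%:R / 2 :> R by rewrite divr_ge0 // mulr_ge0.
apply: le_trans (lerD (ler_wpM2l J1 I2) (ler_wpM2l J2 I1)).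
rewrite (big k.+3) (big_ord_recr k.+3.+1) (big_ord_recr k.+3) /=.
set P := \prod_(i < k.+3) _.
have P0 : 0 <= P by apply: prodr_ge0 => i _; rewrite addr_ge0 // invr_ge0.
rewrite -[k.+3.+2]addn2 -[k.+3.+1]addn1 !natrD.
have : 0 <= (k.+3)%:R :> R by [].
move: (k.+3)%:R => x x0; rewrite -subr_ge0.
set D := (X in 0 <= X); have -> : D = P / 5 * (x + 5 / 4) by rewrite /D; field.
by rewrite !(mulr_ge0, addr_ge0, invr_ge0).
Qed.

Lemma nsc_weight_lower k S : #|S| = k ->
  2^-1 ^+ (#|V| - k) * ewens_lower k <= nsc_weight S.
Proof.
have w0 S' : 0 <= nsc_weight S'.
  by apply: sumr_ge0 => s _; rewrite exprn_ge0 // invr_ge0.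
elim/ltn_ind: k S => -[|[|[|k]]] IH S cS.
- rewrite mulr1 subn0.
  have h1 : no_short_cycle S 1%g.
    by rewrite /no_short_cycle perm_on1; apply/forall_inP => v; move/eqP: cS;
       rewrite cards_eq0 => /eqP ->; rewrite inE.
  rewrite /nsc_weight (bigD1 1%g) //= card_porbits1 lerDl.
  by apply: sumr_ge0 => s _; rewrite exprn_ge0 // invr_ge0.
- by rewrite mulr0.
- by rewrite mulr0.
have [v vS] : exists v, v \in S by apply/card_gt0P; rewrite cS.
have c1 : #|S :\ v| = k.+2 by move: cS; rewrite (cardsD1 v) vS => -[].
have kn : (k.+3 <= #|V|)%N by rewrite -cS max_card.
apply: le_trans (nsc_weight_rec vS).
have c2 a : a \in S :\ v -> #|S :\ v :\ a| = k.+1.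
  by move=> aS; move: c1; rewrite (cardsD1 a) aS => -[].
have c3 a b : a \in S :\ v -> b \in S :\ v :\ a -> #|S :\ v :\ a :\ b| = k.
  by move=> aS bS; move: (c2 _ aS); rewrite (cardsD1 b) bS => -[].
set m := (#|V| - k.+3)%N.
have e1 : (#|V| - k.+2 = m.+1)%N by rewrite /m; lia.
have e2 : (#|V| - k = m.+3)%N by rewrite /m; lia.
apply: (@le_trans _ _ (\sum_(a in S :\ v) (2 * (2^-1 ^+ m.+1 * ewens_lower k.+2)
   + k.+1%:R * (4 * (2^-1 ^+ m.+3 * ewens_lower k))))); last first.
  apply: ler_sum => a aS; apply: lerD; first by rewrite ler_wpM2l // -e1; apply: IH.
  rewrite -(c2 _ aS) mulr_natl -sumr_const; apply: ler_sum => b bS.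
  by rewrite ler_wpM2l // -e2; apply: IH => //; [lia|apply: c3].
rewrite sumr_const c1 -[X in _ <= X]mulr_natl; apply: le_of_eq.
have -> : ewens_lower k.+3
   = k.+2%:R * ewens_lower k.+2 + k.+2%:R * k.+1%:R / 2 * ewens_lower k by [].
by rewrite !exprS; field.
Qed.

End NoShortCycleWeight.

(** * Orientations of 2-regular graphs *)

Section PermutationGraphs.
Variable V : finType.
Implicit Types (F G : sgraph V) (p : {perm V}).

Lemma adjC F u v : adj F u v = adj F v u.
Proof. by rewrite /adj setUC. Qed.

Lemma adj_neq F u v : adj F u v -> u != v.
Proof.
move=> uv; have := forall_inP (edges_card2 F) _ uv.
by rewrite cards2; case: (u != v).
Qed.

Lemma sgraph_eq F G : adj F =2 adj G -> F = G.
Proof.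
have sub F1 F2 : adj F1 =2 adj F2 -> edges F1 \subset edges F2.
  move=> eqa; apply/subsetP => e eF.
  have /forall_inP/(_ e eF)/cards2P [x [y [xy ee]]] := edges_card2 F1.
  have : adj F1 x y by rewrite /adj -ee.
  by rewrite eqa /adj -ee.
by move=> eqa; apply: val_inj; apply/eqP; rewrite eqEsubset !sub.
Qed.

Lemma permgraph_card2 p :
  [forall e in [set e : {set V} | (#|e| == 2) && [exists v, e == [set v; p v]]],
     #|e| == 2].
Proof. by apply/forall_inP => e; rewrite inE => /andP[]. Qed.

Definition permgraph p : sgraph V := SGraph (permgraph_card2 p).

Lemma no_short_cycleP p :
  reflect (forall v, p v != v /\ p (p v) != v) (no_short_cycle [set: V] p).
Proof.
apply: (iffP andP) => [[_ /forall_inP H] v|H].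
  by have /andP := H v (in_setT v).
split; first by apply/subsetP => x; rewrite inE.
by apply/forall_inP => v _; apply/andP.
Qed.

Lemma adj_permgraph p u v : no_short_cycle [set: V] p ->
  adj (permgraph p) u v = (v == p u) || (u == p v).
Proof.
move/no_short_cycleP => p3; rewrite /adj inE cards2.
apply/andP/orP => [[uv /existsP[w /eqP e]]|].
  have neq : u != v by move: uv; case: (u != v).
  have : u \in [set w; p w] by rewrite -e set21.
  have : v \in [set w; p w] by rewrite -e set22.
  rewrite !inE => /orP[]/eqP ev /orP[]/eqP eu; rewrite eu ev.
  - by rewrite eu ev eqxx in neq.
  - by right.
  - by left.
  - by rewrite eu ev eqxx in neq.
have pn w : p w != w by case: (p3 w).
case=> /eqP->; split.
- by rewrite [u == _]eq_sym pn.
- by apply/existsP; exists u.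
- by rewrite pn.
- by apply/existsP; exists v; rewrite setUC.
Qed.

Lemma permgraph_regular p :
  no_short_cycle [set: V] p -> permgraph p \in regular_graphs V 2.
Proof.
move=> p3; rewrite inE; apply/forallP => v; rewrite /degree.
have -> : [set u | adj (permgraph p) v u] = [set p v; (p^-1)%g v].
  apply/setP => u; rewrite !inE adj_permgraph //; congr (_ || _).
  by apply/eqP/eqP => [->|->]; rewrite ?permK ?permKV.
rewrite cards2; have [_ ppv] := no_short_cycleP _ p3 ((p^-1)%g v).
by rewrite permKV in ppv; rewrite ppv.
Qed.

Section Orientation.
Variable F : sgraph V.
Hypothesis F2 : F \in regular_graphs V 2.

Let nbr v := [set u | adj F v u].

Let card_nbr v : #|nbr v| = 2.
Proof. by move: F2; rewrite inE => /forallP/(_ v)/eqP. Qed.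

Let other u v := odflt u [pick w in nbr v :\ u].

Let otherP u v : adj F u v -> adj F v (other u v) /\ other u v != u.
Proof.
move=> uv; rewrite /other; case: pickP => [w|no].
  by rewrite !inE => /andP[-> ->].
have := card_nbr v; rewrite (cardsD1 u) inE adjC uv.
by have -> : nbr v :\ u = set0 by [apply/setP => w; rewrite [LHS]no inE]; rewrite cards0.
Qed.

Let other_uniq u v w : adj F u v -> adj F v w -> w != u -> w = other u v.
Proof.
move=> uv vw wu; have [vo ou] := otherP uv.
have /eqP/cards1P[z nz] : #|nbr v :\ u| = 1.
  by have := card_nbr v; rewrite (cardsD1 u) inE adjC uv => -[].
have : w \in nbr v :\ u by rewrite !inE wu.
have : other u v \in nbr v :\ u by rewrite !inE ou.
by rewrite nz !inE => /eqP-> /eqP.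
Qed.

(* A dart is an ordered pair of adjacent vertices; [step] walks along a cycle. *)
Let step (d : V * V) := if adj F d.1 d.2 then (d.2, other d.1 d.2) else d.
Let back (d : V * V) := if adj F d.1 d.2 then (other d.2 d.1, d.1) else d.
Let rev (d : V * V) := (d.2, d.1).

Let stepK : cancel step back.
Proof.
move=> [u v]; rewrite /step /=; case: ifP => [uv|nuv]; last by rewrite /back /= nuv.
have [vo ou] := otherP uv; rewrite /back /= vo; congr (_, _).
by symmetry; apply: other_uniq; rewrite 1?adjC // eq_sym.
Qed.

Let phi : {perm V * V} := perm (can_inj stepK).

Let adj_phi d : adj F (phi d).1 (phi d).2 = adj F d.1 d.2.
Proof.
rewrite permE /step; case: ifP => // uv /=; by have [] := otherP uv.
Qed.

Let adj_phiX i d : adj F ((phi ^+ i)%g d).1 ((phi ^+ i)%g d).2 = adj F d.1 d.2.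
Proof. by elim: i => [|i IH]; rewrite ?expg0 ?perm1 // expgSr permM adj_phi. Qed.

Let phi_rev d : phi (rev (phi d)) = rev d.
Proof.
case: d => u v; rewrite !permE /step /=.
case uv: (adj F u v) => /=; last by rewrite adjC uv.
have [vo ou] := otherP uv; rewrite adjC vo; congr (_, _).
by symmetry; apply: other_uniq; rewrite 1?adjC // eq_sym.
Qed.

Let phiX_rev i d : (phi ^+ i)%g (rev ((phi ^+ i)%g d)) = rev d.
Proof.
elim: i d => [|i IH] d; first by rewrite !expg0 !perm1.
by rewrite {1}expgSr expgS !permM IH phi_rev.
Qed.

(* If rev d were reached from d in k steps, the dart e in the middle of the walk
   would satisfy e = rev e for even k, and step e = rev e for odd k. *)
Let rev_notin d : adj F d.1 d.2 -> rev d \notin porbit phi d.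
Proof.
move=> ad; apply/porbitP => -[k ek].
pose e := (phi ^+ k./2)%g d.
have ae : adj F e.1 e.2 by rewrite adj_phiX.
have revE : rev d = (phi ^+ k./2)%g (rev e) by rewrite /e phiX_rev.
move: ek; rewrite revE -{2}(odd_double_half k) -addnn; case: (odd k).
  rewrite addnCA expgD add1n expgS !permM -/e => /perm_inj.
  rewrite permE /step ae => -[] /esym; apply/eqP.
  by have [_] := otherP ae.
rewrite add0n expgD permM -/e => /perm_inj /(congr1 fst) /= e12.
by have := adj_neq ae; rewrite e12 eqxx.
Qed.

(* Of the two orbits of d and rev d, select the one of smaller rank. *)
Let positive (d : V * V) :=
  (enum_rank (porbit phi d) < enum_rank (porbit phi (rev d)))%N.

Let positive_rev d : adj F d.1 d.2 -> positive (rev d) = ~~ positive d.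
Proof.
move=> ad; rewrite /positive /rev /= -surjective_pairing -/(rev d) -leqNgt.
rewrite ltn_neqAle andbC; case: leqP => //= _.
apply: contra (rev_notin ad) => /eqP /val_inj /enum_rank_inj <-.
exact: porbit_id.
Qed.

Let positive_phi d : positive (phi d) = positive d.
Proof.
have phi1 z : porbit phi (phi z) = porbit phi z := porbit_perm phi 1 z.
by rewrite /positive phi1 -[porbit phi (rev (phi d))]phi1 phi_rev.
Qed.

Let positive_out u v w :
  adj F v u -> adj F v w -> u != w -> positive (v, w) = ~~ positive (v, u).
Proof.
move=> vu vw uw; have uv : adj F u v by rewrite adjC.
have -> : (v, w) = phi (u, v).
  by rewrite permE /step /= uv; congr (_, _); apply: other_uniq; rewrite // eq_sym.
by rewrite positive_phi -[(u, v)]/(rev (v, u)) positive_rev.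
Qed.

Let next v := odflt v [pick w | adj F v w && positive (v, w)].

Let nextP v : adj F v (next v) && positive (v, next v).
Proof.
rewrite /next; case: pickP => //= no.
have /cards2P[u [w [uw nE]]] : #|nbr v| == 2 by rewrite card_nbr.
have vu : adj F v u by have := set21 u w; rewrite -nE inE.
have vw : adj F v w by have := set22 u w; rewrite -nE inE.
have := no u; have := no w; rewrite vu vw (positive_out vu vw uw) /=.
by case: positive.
Qed.

Let next_uniq v w : adj F v w -> positive (v, w) -> w = next v.
Proof.
move=> vw pw; have /andP[vn pn] := nextP v.
by apply/eqP/negPn/negP => neq; rewrite (positive_out vw vn neq) pw in pn.
Qed.

Let next_inj : injective next.
Proof.
move=> v v' eqn; have /andP[vw pv] := nextP v; have /andP[vw' pv'] := nextP v'.
apply/eqP/negPn/negP => neq; rewrite -eqn in vw' pv'.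
have wv : adj F (next v) v by rewrite adjC.
have wv' : adj F (next v) v' by rewrite adjC.
have := positive_out wv wv' neq.
rewrite -[(next v, v)]/(rev (v, next v)) -[(next v, v')]/(rev (v', next v)).
by rewrite !positive_rev //= pv pv'.
Qed.

(** Walk along the cycles by passing from the dart (u, v) to the dart (v, w),
    where w is the other neighbour of v. Reversing darts turns the walk around,
    and no dart is in the same orbit as its reverse; so one orbit can be selected
    from every pair of mutually reverse orbits. The darts in the selected orbits
    orient all the cycles: exactly one of the two darts that leave v is
    selected. *)
Lemma orientation_exists :
  exists2 p, no_short_cycle [set: V] p & permgraph p = F.
Proof.
pose p := perm next_inj.
have p3 : no_short_cycle [set: V] p.
  apply/no_short_cycleP => v; rewrite !permE.
  have /andP[vw pv] := nextP v; have /andP[vw' pv'] := nextP (next v).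
  split; first by rewrite eq_sym (adj_neq vw).
  apply/eqP => eqv; rewrite eqv in pv'.
  by have := positive_rev (d := (v, next v)) vw; rewrite /rev /= pv' pv.
exists p => //; apply: sgraph_eq => u v; rewrite adj_permgraph // !permE.
apply/orP/idP => [[]/eqP->|uv].
- by have /andP[] := nextP u.
- by rewrite adjC; have /andP[] := nextP v.
case: (boolP (positive (u, v))) => [pu|pu].
  by left; rewrite -(next_uniq uv pu).
right; apply/eqP/next_uniq; first by rewrite adjC.
by rewrite -[(v, u)]/(rev (u, v)) positive_rev.
Qed.

End Orientation.

(** An orientation of the same graph coincides on every cycle with p or with its
    inverse, and these differ at each point since cycles have length at least
    three. So orientations correspond to sets of cycles to be reversed. *)
Lemma card_orientations p : no_short_cycle [set: V] p ->
  #|[set q | no_short_cycle [set: V] q & permgraph q == permgraph p]|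
    = (2 ^ #|porbits p|)%N.
Proof.
move=> p3; have /no_short_cycleP pP := p3.
have porb1 v : porbit p (p v) = porbit p v := porbit_perm p 1 v.
have porbV v : porbit p (p^-1 v)%g = porbit p v by rewrite -porb1 permKV.
pose flip (D : {set {set V}}) v := if porbit p v \in D then (p^-1)%g v else p v.
have flipO D v : porbit p (flip D v) = porbit p v.
  by rewrite /flip; case: ifP; rewrite ?porb1 ?porbV.
have flip_inj D : injective (flip D).
  move=> u v e; have := congr1 (porbit p) e; rewrite !flipO => eo.
  by move: e; rewrite /flip eo; case: ifP => _ /perm_inj.
have flip3 D : no_short_cycle [set: V] (perm (@flip_inj D)).
  apply/no_short_cycleP => v; rewrite !permE /flip.
  case: ifP => vD; rewrite ?porbV ?porb1 vD; last exact: pP.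
  have [h1 h2] := pP ((p^-1)%g ((p^-1)%g v)).
  rewrite !permKV in h1 h2; split; last by rewrite eq_sym.
  by have [] := pP ((p^-1)%g v); rewrite permKV eq_sym.
have flipE D : permgraph (perm (@flip_inj D)) = permgraph p.
  apply: sgraph_eq => u v; rewrite !adj_permgraph // !permE.
  have Vl a b : (a == (p^-1)%g b) = (b == p a).
    by apply/eqP/eqP => ->; rewrite ?permK ?permKV.
  case: (eqVneq (porbit p u) (porbit p v)) => [eo|/eqP neo].
    by rewrite /flip eo; case: ifP => _; rewrite ?Vl // orbC.
  have no a b : porbit p a <> porbit p b -> (b == flip D a) || (b == p a) = false.
    by move=> nab; apply/negP => /orP[] /eqP e; case: nab; rewrite e ?flipO ?porb1.
  have /norP[/negPf-> /negPf->] := negbT (no u v neo).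
  by have /norP[/negPf-> /negPf->] := negbT (no v u (nesym neo)).
rewrite -card_powerset -(card_in_imset (f := fun D => perm (@flip_inj D))).
  apply: eq_card => q; rewrite inE; apply/andP/imsetP => [[q3 /eqP qp]|[D _ ->]];
    last by rewrite flip3 flipE.
  have /no_short_cycleP qP := q3.
  have qV v : q v = p v \/ q v = (p^-1)%g v.
    have : adj (permgraph p) v (q v) by rewrite -qp adj_permgraph // eqxx.
    rewrite adj_permgraph // => /orP[/eqP|/eqP e]; first by left.
    by right; rewrite [in RHS]e permK.
  have pq1 v : q v = p v -> q (p v) = p (p v).
    move=> e; case: (qV (p v)) => //; rewrite permK -e => e'.
    by have [_] := qP v; rewrite e' eqxx.
  have pqX v w : w \in porbit p v -> q v = p v -> q w = p w.
    move=> /porbitP[i ->] e; elim: i => [|i IH]; first by rewrite expg0 perm1.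
    by rewrite expgSr permM pq1.
  exists [set porbit p v | v in [set v | q v != p v]].
    by rewrite inE; apply/subsetP => _ /imsetP[v _ ->]; apply: imset_f.
  apply/permP => v; rewrite permE /flip; case: ifP => [/imsetP[w]|/negbT nv].
    rewrite inE => qw /eqP; rewrite eq_porbit_mem => vw.
    case: (qV v) => // e; case/eqP: qw; apply: pqX e.
    by rewrite porbit_sym.
  by apply/eqP/negPn/negP => h; case/negP: nv; apply: imset_f; rewrite inE.
move=> D D'; rewrite !inE => /subsetP sD /subsetP sD' /permP eqf.
have mem v : (porbit p v \in D) = (porbit p v \in D').
  have := eqf v; rewrite !permE /flip; have [_] := pP ((p^-1)%g v).
  rewrite permKV => neq; case: ifP; case: ifP => // _ _ e; first by rewrite e eqxx in neq.
  by rewrite e eqxx in neq.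
apply/setP => C; apply/idP/idP => CD.
  by have /imsetP[v _ eC] := sD _ CD; rewrite eC -mem -eC.
by have /imsetP[v _ eC] := sD' _ CD; rewrite eC mem -eC.
Qed.

Lemma sum_regular_graphs (R : numFieldType) (f : sgraph V -> R) :
  \sum_(F in regular_graphs V 2) f F
    = \sum_(p | no_short_cycle [set: V] p) 2^-1 ^+ #|porbits p| * f (permgraph p).
Proof.
rewrite [RHS](partition_big permgraph (mem (regular_graphs V 2))) /=; last first.
  exact: permgraph_regular.
apply: eq_bigr => F F2; have [p p3 pF] := orientation_exists F2.
have cE q : no_short_cycle [set: V] q -> permgraph q = F ->
    2^-1 ^+ #|porbits q| = (2 ^+ #|porbits p|)^-1 :> R.
  move=> q3 qF; rewrite exprVn; suff -> : #|porbits q| = #|porbits p| by [].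
  by apply/eqP; rewrite -(eqn_exp2l _ _ (isT : 1 < 2)%N) -!card_orientations // qF pF.
rewrite (eq_bigr (fun=> (2 ^+ #|porbits p|)^-1 * f F)); last first.
  by move=> q /andP[q3 /eqP qF]; rewrite cE // qF.
rewrite sumr_const -[RHS]mulr_natl.
have -> : #|[pred q | no_short_cycle [set: V] q & permgraph q == F]|
   = (2 ^ #|porbits p|)%N.
  by rewrite -card_orientations //; apply: eq_card => q; rewrite !inE pF.
by rewrite natrX mulrA mulfV ?mul1r // expf_neq0.
Qed.

End PermutationGraphs.

(** * From merged cycles to a Hamilton cycle *)

Section HamiltonianUnion.
Variables (V : finType) (G : sgraph V).

Definition relabel_adj (s : {perm V}) : rel V := fun u v => adj G (s u) (s v).

Lemma adj_gunion F u v : adj (gunion G F) u v = adj G u v || adj F u v.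
Proof. by rewrite /adj inE. Qed.

Lemma no_short_cycleJ (s p : {perm V}) :
  no_short_cycle [set: V] (p ^ s)%g = no_short_cycle [set: V] p.
Proof.
apply/no_short_cycleP/no_short_cycleP => H v.
  by have [] := H (s v); rewrite !permJ !(inj_eq perm_inj).
have -> : v = s (s^-1 v)%g by rewrite permKV.
by have [] := H (s^-1 v)%g; rewrite !permJ !(inj_eq perm_inj).
Qed.

Lemma porbitJ (s p : {perm V}) v : porbit (p ^ s)%g (s v) = s @: porbit p v.
Proof.
have pX i : ((p ^ s) ^+ i)%g (s v) = s ((p ^+ i)%g v) by rewrite -conjXg permJ.
apply/setP => w; apply/porbitP/imsetP => [[i ->]|[_ /porbitP[i ->] ->]].
  by exists ((p ^+ i)%g v); rewrite ?mem_porbit ?pX.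
by exists i; rewrite pX.
Qed.

Lemma card_porbitsJ (s p : {perm V}) : #|porbits (p ^ s)%g| = #|porbits p|.
Proof.
have -> : porbits (p ^ s)%g = [set s @: (C : {set V}) | C in porbits p].
  apply/setP => C; apply/imsetP/imsetP => [[v _ ->]|[_ /imsetP[v _ ->] ->]].
    exists (porbit p (s^-1 v)%g); first exact: imset_f.
    by rewrite -porbitJ permKV.
  by exists (s v); rewrite ?porbitJ.
by rewrite card_imset //; apply/imset_inj/perm_inj.
Qed.

(** The remaining cycle runs through all vertices; it uses edges of G at the
    points of D and edges of p elsewhere. *)
Lemma hamiltonian_merged (s p : {perm V}) D k :
    (2 < #|V|)%N -> no_short_cycle [set: V] p ->
    merged (relabel_adj s) p D k -> #|porbits p| = k.+1 ->
  hamiltonian (gunion G (permgraph (p ^ s)%g)).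
Proof.
move=> V3 p3 [rho [rhoN rhoD ck]] pk.
have one : #|porbits rho| = 1 by move: ck; rewrite pk => ck; lia.
have /card_gt0P[x0 _] : (0 < #|V|)%N by apply: leq_trans V3.
have all_in v : v \in fingraph.orbit rho x0.
  rewrite -fconnect_orbit.
  have /eqP/cards1P[C eC] := one.
  have : porbit rho v \in porbits rho by apply: imset_f.
  have : porbit rho x0 \in porbits rho by apply: imset_f.
  rewrite eC !inE => /eqP e0 /eqP ev.
  have : v \in porbit rho x0 by rewrite e0 -ev porbit_id.
  by move=> /porbitP[i ->]; rewrite permX fconnect_iter.
have u0 : uniq (fingraph.orbit rho x0) := orbit_uniq rho x0.
apply/hamiltonianP; exists (map s (fingraph.orbit rho x0)); split; last first.
  by move=> v; rewrite -[v](permKV s) map_f.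
apply/and3P; split.
- rewrite size_map -(card_uniqP u0).
  by rewrite (leq_trans V3) // subset_leq_card //; apply/subsetP.
- by rewrite map_inj_uniq //; apply: perm_inj.
rewrite cycle_map; have := cycle_orbit (@perm_inj _ rho) x0.
apply: sub_cycle => v _ /eqP <- /=; rewrite adj_gunion.
case: (boolP (v \in D)) => [vD|vD]; first by rewrite -/(relabel_adj s _ _) rhoD.
by rewrite rhoN // adj_permgraph ?no_short_cycleJ // permJ eqxx orbT.
Qed.

End HamiltonianUnion.

(** * Avoiding large target sets *)

Section AvoidingTargets.
Variables (V : finType) (R : realFieldType) (d : nat).
Implicit Types (s : {perm V}) (Z : {set V}).

Let q : R := d%:R / (2 * #|V|%:R).

(** The value s p has to avoid both the occupied values and the target, which
    leaves at most n - d of the n - |Z| free values; as |Z| is at most d/2, the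
    quotient is at most 1 - d/2n. *)
Lemma avoid_fresh Z p (f : {perm V} -> R) (T : {perm V} -> {set V}) :
    p \notin Z -> (2 * #|Z| <= d)%N -> (d <= #|V|)%N ->
    (forall s, 0 <= f s) -> (forall s, f s != 0 -> (d <= #|T s|)%N) ->
    (forall s s', {in Z, s =1 s'} -> f s = f s') ->
    (forall s s', {in Z, s =1 s'} -> T s = T s') ->
  \sum_s f s * (s p \notin T s)%:R <= (1 - q) * \sum_s f s.
Proof.
move=> pZ Zd dV f0 Td fZ TZ.
have Zn : (#|Z| < #|V|)%N.
  by rewrite -cardsT proper_card // properT; apply: contraNneq pZ => ->; rewrite inE.
have n0 : 0 < #|V|%:R :> R by rewrite ltr0n (leq_ltn_trans _ Zn).
have c0 : 0 < (#|V| - #|Z|)%:R :> R by rewrite ltr0n subn_gt0.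
rewrite -(ler_pM2r c0) mulr_natr.
rewrite (sum_fresh_image (h := fun s w => f s * (w \notin T s)%:R) pZ); last first.
  by move=> s s' eqs w; rewrite (fZ _ _ eqs) (TZ _ _ eqs).
apply: (@le_trans _ _ ((#|V| - d)%:R * \sum_s f s)).
  rewrite mulr_sumr; apply: ler_sum => s _.
  rewrite -mulr_sumr mulrC; case: (eqVneq (f s) 0) => [->|fs0]; first by rewrite !mulr0.
  rewrite ler_wpM2r // -natr_sum ler_nat -big_mkcondr /= sum1_card.
  have sT : (d <= #|(s @: Z) :|: T s|)%N.
    by apply: leq_trans (Td s fs0) (subset_leq_card (subsetUr _ _)).
  apply: leq_trans (leq_sub2l _ sT).
  rewrite -[in leqRHS](cardsC ((s @: Z) :|: T s)) addKn subset_leq_card //.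
  by apply/subsetP => w; rewrite !inE negb_or.
rewrite -[leRHS]mulrAC ler_wpM2r ?sumr_ge0 //.
have qn : q * #|V|%:R = d%:R / 2 by rewrite /q; field; rewrite gt_eqF.
have q0 : 0 <= q by rewrite divr_ge0 // mulr_ge0.
have Zd' : 2 * #|Z|%:R <= d%:R :> R by rewrite -natrM ler_nat.
rewrite !natrB // ?(ltnW Zn) //.
have : 0 <= q * #|Z|%:R by rewrite mulr_ge0.
move: qn Zd'; move: q (#|V|%:R : R) (#|Z|%:R : R) (d%:R : R) => a b c e.
by move=> *; nra.
Qed.

(** Replace the factors one at a time by their conditional bounds. The factor of
    index i depends, once the values on Z are known, on s (p i) only, so p i may
    be regarded as the last point to be exposed. *)
Lemma avoid_many K (p : 'I_K -> V) Z (b : {perm V} -> 'I_K -> bool)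
    (T : {perm V} -> 'I_K -> {set V}) :
    injective p -> (forall i, p i \notin Z) -> (2 * (#|Z| + K) <= d)%N ->
    (d <= #|V|)%N ->
    (forall s i, b s i -> (d <= #|T s i|)%N) ->
    (forall s s', {in Z, s =1 s'} -> b s =1 b s' /\ T s =1 T s') ->
  \sum_s \prod_(i < K) (b s i ==> (s (p i) \notin T s i))%:R
    <= \sum_s \prod_(i < K) (1 - q) ^+ b s i.
Proof.
move=> pI pZ Zd dV Td loc.
have q1 : 0 <= 1 - q.
  rewrite subr_ge0 /q; case: (posnP #|V|) => [->|n0]; first by rewrite mulr0 invr0 mulr0.
  rewrite ler_pdivrMr ?mul1r; last by rewrite -natrM ltr0n muln_gt0.
  by rewrite -natrM ler_nat (leq_trans dV) // leq_pmull.
pose miss s i : R := (b s i ==> (s (p i) \notin T s i))%:R.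
(* The first m factors are still indicators, the others are replaced. *)
pose Phi m s := \prod_(i < K) (if (i < m)%N then miss s i else (1 - q) ^+ b s i).
suff main m : (m <= K)%N -> \sum_s Phi m s <= \sum_s Phi 0 s.
  rewrite (eq_bigr (Phi K)) => [|s _].
    by rewrite [leRHS](eq_bigr (Phi 0)) ?main.
  by rewrite /Phi; apply: eq_bigr => i _; rewrite ltn_ord.
elim: m => [//|m IH] mK; apply: le_trans (IH (ltnW mK)).
pose i0 := Ordinal mK.
pose f s := \prod_(i < K | i != i0) (if (i < m)%N then miss s i else (1 - q) ^+ b s i).
pose Z' := Z :|: [set p i | i in [set~ i0]].
have f0 s : 0 <= f s.
  by apply: prodr_ge0 => i _; case: ifP; rewrite ?exprn_ge0.
have pZ' : p i0 \notin Z'.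
  rewrite inE negb_or pZ; apply/imsetP => -[i]; rewrite !inE => ni /pI e.
  by rewrite e eqxx in ni.
have Z'd : (2 * #|Z'| <= d)%N.
  apply: leq_trans Zd; rewrite leq_mul2l /=.
  apply: leq_trans (leq_card_setU _ _) _; rewrite leq_add2l.
  by apply: leq_trans (leq_imset_card _ _) _; rewrite cardsC1 card_ord leq_pred.
have loc' s s' : {in Z', s =1 s'} -> {in Z, s =1 s'}.
  by move=> e z zZ; apply: e; rewrite inE zZ.
have fZ s s' : {in Z', s =1 s'} -> f s = f s'.
  move=> e; have [eb eT] := loc _ _ (loc' _ _ e); apply: eq_bigr => i ni.
  rewrite /miss !eb !eT e //; rewrite inE; apply/orP; right; apply: imset_f.
  by rewrite !inE.
have split_b s g : f s * g s = f s * (b s i0)%:R * g s + f s * (~~ b s i0)%:R * g s.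
  by case: (b s i0); rewrite /= ?mulr0 ?mulr1 ?mul0r ?addr0 ?add0r.
have PhiS s : Phi m.+1 s = f s * miss s i0.
  rewrite /Phi (bigD1 i0) //= ltnSn mulrC; congr (_ * _); apply: eq_bigr => i ni.
  by rewrite ltnS leq_eqVlt (negPf (ni : nat_of_ord i != m)).
have Phi_ s : Phi m s = f s * (1 - q) ^+ b s i0.
  by rewrite /Phi (bigD1 i0) //= ltnn mulrC.
rewrite (eq_bigr _ (fun s _ => PhiS s)) (eq_bigr _ (fun s _ => Phi_ s)).
rewrite (eq_bigr _ (fun s _ => split_b s (miss^~ i0))) big_split /=.
rewrite [leRHS](eq_bigr _ (fun s _ => split_b s (fun s => (1 - q) ^+ b s i0))).
rewrite [leRHS]big_split /=; apply: lerD; last first.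
  apply: ler_sum => s _; rewrite /miss; case: (b s i0); rewrite /= ?mulr0 ?mul0r //.
rewrite [leLHS](eq_bigr (fun s => f s * (b s i0)%:R * (s (p i0) \notin T s i0)%:R)).
  rewrite [leRHS](eq_bigr (fun s => (1 - q) * (f s * (b s i0)%:R))) -?mulr_sumr.
    apply: (avoid_fresh pZ') => // [s|s|s s' e|s s' e].
    - by rewrite mulr_ge0.
    - by case: (boolP (b s i0)) => [/Td|]; rewrite ?mulr0 ?eqxx.
    - by rewrite (fZ _ _ e); have [-> _] := loc _ _ (loc' _ _ e).
    - by have [_ ->] := loc _ _ (loc' _ _ e).
  by move=> s _; case: (b s i0); rewrite ?expr1 ?mulr0 ?mul0r // mulrC.
by move=> s _; rewrite /miss; case: (b s i0); rewrite ?mulr0 ?mul0r.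
Qed.

End AvoidingTargets.

(** * Linking two long cycles *)

Section LongCycles.
Variables (V : finType) (R : realFieldType) (d : nat) (e : rel V).
Hypothesis deg : forall v, (d <= #|[set w | e v w]|)%N.
Implicit Types s : {perm V}.

Let q : R := d%:R / (2 * #|V|%:R).

(** First expose the images of all x i, u j and v j. Call i good if some v j lands
    in the neighbourhood of x i; a given i is bad with probability at most
    (1 - q)^K, so by the Markov inequality at least half of the indices are good
    with high probability. Then expose the images of the y i: for each good i
    there is a fresh chance q that y i lands in the neighbourhood of its partner
    u j. *)
Lemma cross_edges_fail K (x y u v : 'I_K -> V) :
    injective v -> injective y ->
    (forall i j, v j != x i) ->
    (forall i j, [/\ y i != x j, y i != u j & y i != v j]) ->
    (8 * K <= d)%N ->
  \sum_(s : {perm V}) [forall i, forall j,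
            ~~ (e (s (x i)) (s (v j)) && e (s (u j)) (s (y i)))]%:R
    <= 3 * (1 - q) ^+ K./2 * #|{perm V}|%:R.
Proof.
move=> vI yI vx yxuv Kd.
set N := #|{perm V}|.
have sum1 : \sum_(s : {perm V}) 1 = N%:R :> R by rewrite sumr_const.
case: (posnP K) => [K0|Kpos].
  rewrite [X in X./2]K0 mulr1; apply: (@le_trans _ _ N%:R).
    by rewrite -sum1; apply: ler_sum => s _; rewrite lern1 leq_b1.
  by rewrite ler_peMl // ler1n.
have dV : (d <= #|V|)%N.
  have i0 := Ordinal Kpos; apply: leq_trans (deg (v i0)) _.
  by rewrite -cardsT subset_leq_card // subsetT.
have q0 : 0 <= q by rewrite divr_ge0 // mulr_ge0.
have q1 : 0 <= 1 - q.
  rewrite subr_ge0 /q; case: (posnP #|V|) => [->|n0]; first by rewrite mulr0 invr0 mulr0.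
  rewrite ler_pdivrMr ?mul1r; last by rewrite -natrM ltr0n muln_gt0.
  by rewrite -natrM ler_nat (leq_trans dV) // leq_pmull.
have qle1 : 1 - q <= 1 by rewrite gerBl.
pose good s i := [exists j, e (s (x i)) (s (v j))].
pose jj s i := odflt i [pick j | e (s (x i)) (s (v j))].
have bad_good i : \sum_(s : {perm V}) (~~ good s i)%:R <= (1 - q) ^+ K * N%:R.
  have := @avoid_many V R d K v [set x i] (fun _ _ => true)
    (fun s _ => [set w | e (s (x i)) w]) vI _ _ dV _ _.
  move=> avoid; apply: le_trans (le_trans (avoid _ _ _ _) _).
  - apply: ler_sum => s _; case: (boolP (good s i)) => [_|].
      by apply: prodr_ge0.
    rewrite negb_exists => /forallP no; rewrite big1 // => j _.
    by rewrite inE no.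
  - by move=> j; rewrite inE.
  - by rewrite cards1; lia.
  - by move=> s _ _; apply: deg.
  - move=> s s' ss'; split=> // j; apply/setP => w; rewrite !inE.
    by rewrite ss' // set11.
  rewrite (eq_bigr (fun=> (1 - q) ^+ K)).
    by rewrite sumr_const mulr_natr.
  by move=> s _; rewrite prodr_const card_ord expr1.
pose Z := [set x i | i : 'I_K] :|: [set u i | i : 'I_K] :|: [set v i | i : 'I_K].
have xZ i : x i \in Z by rewrite !inE imset_f.
have uZ i : u i \in Z by rewrite !inE (imset_f u) ?orbT.
have vZ i : v i \in Z by rewrite !inE (imset_f v) ?orbT.
have cZ : (#|Z| <= 3 * K)%N.
  have c (f : 'I_K -> V) : (#|[set f i | i : 'I_K]| <= K)%N.
    by rewrite (leq_trans (leq_imset_card _ _)) // card_ord.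
  apply: leq_trans (leq_card_setU _ _) _.
  apply: leq_trans (leq_add (leq_card_setU _ _) (c v)) _.
  by apply: leq_trans (leq_add (leq_add (c x) (c u)) (leqnn _)) _; lia.
have := @avoid_many V R d K y Z good
  (fun s i => [set w | e (s (u (jj s i))) w]) yI _ _ dV _ _.
move=> avoid; apply: le_trans (le_trans (avoid _ _ _ _) _).
- apply: ler_sum => s _; case: (boolP [forall i, _]) => [/forallP H|_]; last first.
    by apply: prodr_ge0.
  rewrite big1 // => i _; case: (boolP (good s i)) => //= gi.
  rewrite inE; have : e (s (x i)) (s (v (jj s i))).
    rewrite /jj; case: pickP => //= no; have /existsP[j] := gi.
    by rewrite no.
  by have /forallP/(_ (jj s i)) := H i; case: (e _ (s (v _))) => //= ->.
- move=> i; rewrite !inE !negb_or -andbA; apply/and3P; split;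
    apply/negP => /imsetP[j _ eq_]; have [] := yxuv i j; by rewrite eq_ eqxx.
- lia.
- by move=> s i _; apply: deg.
- move=> s s' ss'.
  have eg i : e (s (x i)) =1 e (s' (x i)) by move=> w; rewrite ss'.
  have ev i j : e (s (x i)) (s (v j)) = e (s' (x i)) (s' (v j)) by rewrite !ss'.
  split=> i; first by apply: eq_existsb => j; rewrite ev.
  have -> : jj s i = jj s' i.
    by rewrite /jj; congr odflt; apply: eq_pick => j; rewrite ev.
  by apply/setP => w; rewrite !inE ss'.
apply: (@le_trans _ _ (\sum_(s : {perm V}) ((1 - q) ^+ K./2
            + 2 / K%:R * \sum_(i < K) (~~ good s i)%:R))).
  apply: ler_sum => s _; rewrite prodrXr -natr_sum.
  set g := (\sum_(i < K) good s i)%N; set b := (\sum_(i < K) ~~ good s i)%N.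
  have gb : (g + b = K)%N.
    rewrite -big_split /= (eq_bigr (fun=> 1%N)) ?sum1_card ?card_ord // => i _.
    by case: (good s i).
  case: (leqP K./2 g) => [Kg|gK].
    by rewrite (le_trans (ler_wiXn2l q1 qle1 Kg)) // lerDl mulr_ge0 // divr_ge0.
  have : 1 <= 2 / K%:R * b%:R :> R.
    rewrite mulrAC ler_pdivlMr ?ltr0n // mul1r -natrM ler_nat.
    by move: gb gK; rewrite -divn2; lia.
  move=> h; apply: le_trans (exprn_ile1 _ _ _) _ => //; apply: le_trans h _.
  by rewrite lerDr exprn_ge0.
rewrite big_split /= sumr_const -mulr_sumr exchange_big /=.
have -> : 3 * (1 - q) ^+ K./2 * N%:R
    = (1 - q) ^+ K./2 *+ N + 2 * ((1 - q) ^+ K./2 * N%:R).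
  by rewrite -mulr_natr; ring.
rewrite lerD2l -mulrA ler_wpM2l //.
have K0 : 0 < K%:R :> R by rewrite ltr0n.
rewrite mulrC ler_pdivrMr //.
apply: le_trans (ler_sum _ (fun i _ => bad_good i)) _.
rewrite sumr_const card_ord -[leLHS]mulr_natr ler_wpM2r // ler_wpM2r //.
by apply: ler_wiXn2l => //; rewrite -divn2 leq_div.
Qed.

End LongCycles.

(** * Absorbing a short cycle *)

Section ShortCycles.
Variables (V : finType) (R : realType) (p : {perm V}).
Hypothesis p_neq : forall w, p w != w.
Variables (U Z0 A B : {set V}) (f0 : {perm V} -> R) (lam : R) (y0 : nat).
Hypothesis f0_ge0 : forall t, 0 <= f0 t.
Hypothesis f0_local : forall t t' : {perm V}, {in Z0, t =1 t'} -> f0 t = f0 t'.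
Hypothesis lam01 : 0 <= lam <= 1.
Implicit Types (t : {perm V}) (S Z : {set V}).

(** In this part t is the inverse of the placement: t a is the position of the
    vertex a on the cycles of p. The positions admitted for mergers form the set
    U. At a bad position a vertex lacks an admissible position or predecessor. *)
Definition bad_positions := [set w | (w \notin U) || ((p^-1)%g w \notin U)].

(** The mergers available when only the vertices of S are exposed; A is part of
    the neighbourhood of one end of an edge of a short cycle, and B of that of the
    other end, while Z0 consists of the two ends. *)
Definition absorbers S t :=
  [set a in A :&: S | (t a \in U) && (p (t a) \in t @: (B :&: S))].

Definition adjacent_in S t := [set a in Z0 :|: S | p (t a) \in t @: (Z0 :|: S)].

Definition misplaced_in S t := [set a in S | t a \in bad_positions].

(** A bound for the number of exposed vertices whose successor or predecessor
    position cannot produce a new absorber. *)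
Definition defect S t := (#|adjacent_in S t| + #|misplaced_in S t|)%N.

(** The exponential moment of the number of absorbers, stopped when the defect
    exceeds y0. *)
Definition penalty S t : R :=
  f0 t * (1 - lam) ^+ #|absorbers S t| * (defect S t <= y0)%N%:R.

Let lam' := lam * (1 - lam / 2).

Lemma penalty_ge0 S t : 0 <= penalty S t.
Proof.
have /andP[_ l1] := lam01.
by rewrite !mulr_ge0 // exprn_ge0 // subr_ge0.
Qed.

Lemma penalty_local S t t' :
  {in Z0 :|: S, t =1 t'} -> penalty S t = penalty S t'.
Proof.
move=> e.
have eS (D : {set V}) : D \subset Z0 :|: S -> t @: D = t' @: D.
  by move=> sD; apply: eq_in_imset => x xD; apply: e; apply: (subsetP sD).
have eZ : t @: (Z0 :|: S) = t' @: (Z0 :|: S) by apply: eS.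
have eB : t @: (B :&: S) = t' @: (B :&: S).
  by apply: eS; apply: subset_trans (subsetIr _ _) (subsetUr _ _).
have eS1 x : x \in S -> t x = t' x by move=> xS; apply: e; rewrite inE xS orbT.
rewrite /penalty /defect; congr (_ * _ ^+ _ * (_ <= _)%N%:R).
- by apply: f0_local => x xZ; apply: e; rewrite inE xZ.
- apply: eq_card => a; rewrite !inE eB; case: (boolP (a \in S)) => [/eS1->|] //.
  by rewrite andbF.
- congr addn; apply: eq_card => a; rewrite !inE ?eZ.
    by case: (boolP (_ || _)) => //= aZS; rewrite e // inE.
  by case: (boolP (a \in S)) => [/eS1->|].
Qed.

Section Step.
Variables (S : {set V}) (c : V).
Hypothesis cZS : c \notin Z0 :|: S.

(* Exposing c at position w creates an absorber whose second vertex is c if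
   [hit1] holds, and one whose first vertex is c if [hit2] holds. *)
Let hit1 t w :=
  [&& c \in B, (p^-1)%g w \in t @: (A :&: S) & (p^-1)%g w \in U].
Let hit2 t w := [&& c \in A, w \in U & p w \in t @: (B :&: S)].

Let cS : c \notin S.
Proof. by move: cZS; rewrite inE negb_or => /andP[]. Qed.

Let absorbers_step t :
  (#|absorbers S t| + hit1 t (t c) + hit2 t (t c) <= #|absorbers (c |: S) t|)%N.
Proof.
pose a1 := (t^-1 (p^-1 (t c)))%g.
pose E1 := if hit1 t (t c) then [set a1] else set0.
pose E2 := if hit2 t (t c) then [set c] else set0.
have c1 : #|E1| = hit1 t (t c) by rewrite /E1; case: ifP; rewrite ?cards1 ?cards0.
have c2 : #|E2| = hit2 t (t c) by rewrite /E2; case: ifP; rewrite ?cards1 ?cards0.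
have pa1 : p (t a1) = t c by rewrite /a1 !permKV.
have a1S : hit1 t (t c) -> a1 \in A :&: S.
  move=> /and3P[_ /imsetP[a aAS ea] _].
  by rewrite /a1 ea permK.
have d1 : [disjoint absorbers S t & E1].
  rewrite disjoint_sym /E1; case: ifP => _; last by rewrite disjoints_subset sub0set.
  rewrite disjoints1 !inE pa1 mem_imset; last exact: perm_inj.
  by rewrite inE (negPf cS) !andbF.
have d2 : [disjoint absorbers S t :|: E1 & E2].
  rewrite disjoint_sym /E2; case: ifP => _; last by rewrite disjoints_subset sub0set.
  rewrite disjoints1 !inE (negPf cS) andbF /= /E1; case: ifP => [h|]; last by rewrite inE.
  rewrite inE; apply: contra cS => /eqP ->.
  by have := a1S h; rewrite inE => /andP[].
rewrite -c1 -c2 -[(#|absorbers S t| + _)%N]cardsUI.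
rewrite (disjoint_setI0 d1) cards0 addn0 -cardsUI (disjoint_setI0 d2) cards0 addn0.
apply: subset_leq_card; apply/subsetP => a; rewrite !inE => /orP[/orP[]|].
- case/and3P=> /andP[-> ->] -> /imsetP[b]; rewrite inE => /andP[bB bS] ->.
  by rewrite orbT /= imset_f // !inE bB bS orbT.
- rewrite /E1; case: ifP => [h|]; last by rewrite inE.
  rewrite inE => /eqP ->; have := a1S h; rewrite inE => /andP[-> ->].
  case/and3P: h => cB _ hU; rewrite orbT /= pa1 imset_f ?andbT.
    by rewrite /a1 permKV.
  by rewrite !inE cB eqxx.
- rewrite /E2; case: ifP => [h|]; last by rewrite inE.
  rewrite inE => /eqP ->; case/and3P: h => cA cU /imsetP[b].
  rewrite inE => /andP[bB bS] ->; rewrite cA eqxx cU /= imset_f //.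
  by rewrite !inE bB bS orbT.
Qed.

Let defect_mono t : (defect S t <= defect (c |: S) t)%N.
Proof.
have sZ : Z0 :|: S \subset Z0 :|: (c |: S) by rewrite setUS // subsetUr.
apply: leq_add; apply: subset_leq_card; apply/subsetP => a; rewrite !inE.
  case/andP => /orP[->|->]; rewrite ?orbT /=; apply: (subsetP (imsetS _ sZ)).
by case/andP => -> ->; rewrite orbT.
Qed.

Let hit1_count t : c \in B ->
  (#|A :&: S| <= \sum_(w | w \notin t @: (Z0 :|: S)) hit1 t w + defect S t)%N.
Proof.
move=> cB; pose D := [set a in A :&: S | (t a \in U) && (p (t a) \notin t @: (Z0 :|: S))].
have : (#|D| <= \sum_(w | w \notin t @: (Z0 :|: S)) hit1 t w)%N.
  rewrite -big_mkcondr sum1_card.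
  rewrite -(card_imset _ (inj_comp (@perm_inj _ p) (@perm_inj _ t))).
  apply: subset_leq_card; apply/subsetP => _ /imsetP[a aD ->] /=.
  move: aD; rewrite inE => /and3P[aAS aU aN].
  by rewrite unfold_in /= aN /hit1 cB permK imset_f.
suff : (#|A :&: S| <= #|D| + defect S t)%N.
  by move=> h1 h2; apply: leq_trans h1 _; rewrite leq_add2r.
have sub : A :&: S \subset D :|: (adjacent_in S t :|: misplaced_in S t).
  apply/subsetP => a aAS; rewrite !inE; move: aAS; rewrite inE => /andP[-> ->] /=.
  by case: (t a \in U); case: (p (t a) \in _); rewrite ?orbT.
apply: leq_trans (subset_leq_card sub) _.
apply: leq_trans (leq_card_setU _ _) _; rewrite leq_add2l.
exact: leq_card_setU.
Qed.

Let hit2_count t : c \in A ->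
  (#|B :&: S| <= \sum_(w | w \notin t @: (Z0 :|: S)) hit2 t w + defect S t)%N.
Proof.
move=> cA; pose pV := (p^-1)%g.
pose D := [set b in B :&: S | (pV (t b) \in U) && (pV (t b) \notin t @: (Z0 :|: S))].
have : (#|D| <= \sum_(w | w \notin t @: (Z0 :|: S)) hit2 t w)%N.
  rewrite -big_mkcondr sum1_card.
  rewrite -(card_imset _ (inj_comp (@perm_inj _ pV) (@perm_inj _ t))).
  apply: subset_leq_card; apply/subsetP => _ /imsetP[b bD ->] /=.
  move: bD; rewrite inE => /and3P[bBS bU bN].
  by rewrite unfold_in /= bN /hit2 cA bU permKV imset_f.
suff : (#|B :&: S| <= #|D| + defect S t)%N.
  by move=> h1 h2; apply: leq_trans h1 _; rewrite leq_add2r.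
pose E := [set b in Z0 :|: S | pV (t b) \in t @: (Z0 :|: S)].
have cE : (#|E| <= #|adjacent_in S t|)%N.
  have finj : injective (fun b => (t^-1)%g (pV (t b))).
    by move=> b b' /perm_inj/perm_inj/perm_inj.
  rewrite -(card_imset _ finj); apply: subset_leq_card.
  apply/subsetP => _ /imsetP[b bE ->].
  move: bE; rewrite inE => /andP[bZS /imsetP[a aZS ea]].
  by rewrite inE ea permK aZS -ea permKV imset_f.
have sub : B :&: S \subset D :|: (E :|: misplaced_in S t).
  apply/subsetP => a aBS; rewrite !inE; move: aBS; rewrite inE => /andP[-> ->] /=.
  by rewrite -/pV; case: (pV (t a) \in U); case: (pV (t a) \in _); rewrite ?orbT.
apply: leq_trans (subset_leq_card sub) _.
apply: leq_trans (leq_card_setU _ _) _; rewrite leq_add2l.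
by apply: leq_trans (leq_card_setU _ _) _; rewrite leq_add2r.
Qed.

(** The position of c is uniform among the free positions. If c is in B, the
    successors of the positions of A :&: S are hits, and if c is in A, the
    predecessors of the positions of B :&: S are; at most y0 hits of each kind
    are lost. Every hit multiplies the penalty by 1 - lam. Writing lam' for
    lam (1 - lam / 2), a double hit costs the factor (1 - lam)^2 = 1 - 2 lam',
    and a single one at most 1 - lam', so the expected factor is bounded
    linearly in the number of hits. *)
Lemma penalty_step :
  \sum_(t : {perm V}) penalty (c |: S) t
    <= expR (- lam' * (((c \in B) * #|A :&: S| + (c \in A) * #|B :&: S|)%:R
                       - 2 * y0%:R) / #|V|%:R)
       * \sum_(t : {perm V}) penalty S t.
Proof.
have /andP[l0 l1] := lam01.
have l'0 : 0 <= lam' by rewrite mulr_ge0 // subr_ge0; lra.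
pose h t w : R := penalty S t * (1 - lam' * (hit1 t w + hit2 t w)%:R).
have le_h t : penalty (c |: S) t <= h t (t c).
  have powS : (1 - lam) ^+ #|absorbers (c |: S) t|
      <= (1 - lam) ^+ #|absorbers S t| * (1 - lam' * (hit1 t (t c) + hit2 t (t c))%:R).
    have l2 : 0 <= 1 - lam by rewrite subr_ge0.
    apply: le_trans (ler_wiXn2l l2 _ (absorbers_step t)) _; first by rewrite gerBl.
    rewrite -addnA exprD ler_wpM2l ?exprn_ge0 // /lam'.
    case: (hit1 t (t c)); case: (hit2 t (t c)); rewrite /= ?expr0 ?expr1 ?expr2; nra.
  have powS0 : 0 <= (1 - lam) ^+ #|absorbers (c |: S) t|.
    by rewrite exprn_ge0 // subr_ge0.
  rewrite /h /penalty; case: (leqP (defect (c |: S) t) y0) => [d1|_]; last first.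
    rewrite mulr0; case: leqP => _; rewrite ?mulr0 ?mul0r // mulr1 -mulrA.
    by rewrite mulr_ge0 // (le_trans powS0).
  by rewrite (leq_trans (defect_mono t) d1) !mulr1 -mulrA ler_wpM2l.
apply: le_trans (ler_sum _ (fun t _ => le_h t)) _.
have h_local (t t' : {perm V}) : {in Z0 :|: S, t =1 t'} -> h t =1 h t'.
  move=> e w; have eS x : x \in S -> t x = t' x.
    by move=> xS; apply: e; rewrite inE xS orbT.
  have eA : t @: (A :&: S) = t' @: (A :&: S).
    by apply: eq_in_imset => x; rewrite inE => /andP[_ /eS].
  have eB : t @: (B :&: S) = t' @: (B :&: S).
    by apply: eq_in_imset => x; rewrite inE => /andP[_ /eS].
  by rewrite /h (penalty_local e) /hit1 /hit2 eA eB.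
set Q := (_%:R - _ : R).
set z := #|Z0 :|: S|.
have zn : (z < #|V|)%N.
  by rewrite -cardsT proper_card // properT; apply: contraNneq cZS => ->; rewrite inE.
have n0 : 0 < #|V|%:R :> R by rewrite ltr0n (leq_ltn_trans _ zn).
have c0 : 0 < (#|V| - z)%:R :> R by rewrite ltr0n subn_gt0.
have cn : (#|V| - z)%:R <= #|V|%:R :> R by rewrite ler_nat leq_subr.
pose Qp := Num.max 0 Q.
have Qp0 : 0 <= Qp by rewrite le_max lexx.
have step : (\sum_(t : {perm V}) h t (t c)) * (#|V| - z)%:R
    <= ((#|V| - z)%:R - lam' * Qp) * \sum_(t : {perm V}) penalty S t.
  rewrite mulr_natr (sum_fresh_image cZS h_local) mulr_sumr; apply: ler_sum => t _.
  rewrite /h -mulr_sumr [leRHS]mulrC.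
  case: (leqP (defect S t) y0) => [dy|dy]; last first.
    by rewrite /penalty leqNgt dy /= !mulr0 !mul0r.
  rewrite ler_wpM2l ?penalty_ge0 // sumrB sumr_const -mulr_sumr -natr_sum.
  have -> : #|[pred w | w \notin t @: (Z0 :|: S)]| = (#|V| - z)%N.
    rewrite /z -(card_imset (mem (Z0 :|: S)) (@perm_inj _ t)).
    rewrite -(cardsC (t @: (Z0 :|: S))) addKn.
    by apply: eq_card => w; rewrite [RHS]inE.
  rewrite lerB // ler_wpM2l // ge_max ler0n /=.
  rewrite /Q lerBlDr -natrM -natrD ler_nat big_split /=.
  set n1 := (\sum_(w | _) _)%N; set n2 := (\sum_(w | _) _)%N.
  have h1 : ((c \in B) * #|A :&: S| <= n1 + y0)%N.
    case: (boolP (c \in B)) => [cB|_]; rewrite ?mul0n // mul1n.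
    by apply: leq_trans (hit1_count t cB) _; rewrite leq_add2l.
  have h2 : ((c \in A) * #|B :&: S| <= n2 + y0)%N.
    case: (boolP (c \in A)) => [cA|_]; rewrite ?mul0n // mul1n.
    by apply: leq_trans (hit2_count t cA) _; rewrite leq_add2l.
  by apply: leq_trans (leq_add h1 h2) _; rewrite addnACA leq_add2l mul2n addnn.
have P0 : 0 <= \sum_(t : {perm V}) penalty S t.
  by apply: sumr_ge0 => t _; apply: penalty_ge0.
rewrite -(ler_pM2r c0); apply: le_trans step _.
rewrite [leRHS]mulrAC; apply: ler_wpM2r => //.
apply: (@le_trans _ _ ((1 - lam' * Qp / #|V|%:R) * (#|V| - z)%:R)).
  rewrite mulrBl mul1r lerB // -[leLHS]mulrA ler_piMr ?(mulr_ge0 l'0 Qp0) //.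
  by rewrite mulrC ler_pdivrMr ?mul1r.
rewrite ler_pM2r //; apply: le_trans (expR_ge1Dx _) _.
rewrite ler_expR !mulNr lerN2 ler_pM2r ?invr_gt0 //; apply: ler_wpM2l => //.
by rewrite le_max lexx orbT.
Qed.

End Step.

(** The number of pairs of distinct vertices in (A :&: S) * (B :&: S); adding c
    to S increases it by the number of potential hits in [penalty_step]. *)
Definition pair_count S : R := (#|A :&: S| * #|B :&: S|)%:R - #|A :&: B :&: S|%:R.

Lemma sum_penalty S : [disjoint Z0 & S] ->
  \sum_(t : {perm V}) penalty S t
    <= expR (- lam' * (pair_count S - 2 * #|S|%:R * y0%:R) / #|V|%:R)
       * \sum_(t : {perm V}) f0 t.
Proof.
have [k cS] : exists k, #|S| = k by exists #|S|.
elim: k S cS => [|k IH] S cS dS.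
  have -> : S = set0 by apply/eqP; rewrite -cards_eq0 cS.
  rewrite /pair_count !setI0 !cards0 mul0n mulr0 mul0r !subr0 mulr0 mul0r expR0 mul1r.
  apply: ler_sum => t _; rewrite /penalty.
  have -> : absorbers set0 t = set0.
    by apply/setP => a; rewrite !inE andbF.
  rewrite cards0 expr0 mulr1 ler_piMr //.
  by rewrite lern1 leq_b1.
have [c cIS] : exists c, c \in S by apply/card_gt0P; rewrite cS.
pose S' := S :\ c.
have eS : S = c |: S' by rewrite setD1K.
have cS' : #|S'| = k by move: cS; rewrite (cardsD1 c) cIS => -[].
have dS' : [disjoint Z0 & S'] by apply: disjointWr dS; apply: subsetDl.
have cZS : c \notin Z0 :|: S'.
  by rewrite !inE eqxx orbF (disjointFl dS).
rewrite [in leLHS]eS; apply: le_trans (penalty_step cZS) _.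
apply: le_trans (ler_wpM2l (expR_ge0 _) (IH _ cS' dS')) _.
rewrite mulrA -expRD ler_wpM2r ?sumr_ge0 // ler_expR.
have cI (D : {set V}) : #|D :&: S| = ((c \in D) + #|D :&: S'|)%N.
  rewrite (cardsD1 c) inE cIS andbT; congr (_ + _)%N; apply: eq_card => x.
  by rewrite !inE; case: (x == c); rewrite ?andbF.
have e : pair_count S = pair_count S'
    + ((c \in B) * #|A :&: S'| + (c \in A) * #|B :&: S'|)%:R.
  rewrite /pair_count !cI inE !natrM !natrD !natrM.
  by case: (c \in A); case: (c \in B); rewrite /=; ring.
rewrite e cS cS' -[k.+1]addn1 natrD; apply: le_of_eq.
by ring.
Qed.

Lemma fresh_hit Z c k (f : {perm V} -> R) (T : {perm V} -> {set V}) :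
    c \notin Z -> (2 * #|Z| <= #|V|)%N -> (forall t, 0 <= f t) ->
    (forall t, (#|T t| <= k)%N) ->
    (forall t t', {in Z, t =1 t'} -> f t = f t') ->
    (forall t t', {in Z, t =1 t'} -> T t = T t') ->
  \sum_(t : {perm V}) f t * (t c \in T t)%:R
    <= 2 * k%:R / #|V|%:R * \sum_(t : {perm V}) f t.
Proof.
move=> cZ Zn f_ge0 Tk fZ TZ.
have n0' : (0 < #|V|)%N by apply/card_gt0P; exists c.
have n0 : 0 < #|V|%:R :> R by rewrite ltr0n.
have := sum_fresh_image (h := fun t w => f t * (w \in T t)%:R) cZ.
move=> fresh; have {fresh}fresh := fresh _; rewrite -mulr_natr in fresh.
have c0 : #|V|%:R / 2 <= (#|V| - #|Z|)%:R :> R.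
  by rewrite ler_pdivrMr // -natrM ler_nat; lia.
have L0 : 0 <= \sum_(t : {perm V}) f t * (t c \in T t)%:R.
  by apply: sumr_ge0 => t _; rewrite mulr_ge0.
have S0 : 0 <= \sum_(t : {perm V}) f t by apply: sumr_ge0.
have step : (\sum_(t : {perm V}) f t * (t c \in T t)%:R) * (#|V|%:R / 2)
    <= k%:R * \sum_(t : {perm V}) f t.
  apply: le_trans (ler_wpM2l L0 c0) _; rewrite fresh; last first.
    by move=> t t' e w; rewrite (fZ _ _ e) (TZ _ _ e).
  rewrite mulr_sumr; apply: ler_sum => t _; rewrite -mulr_sumr mulrC ler_wpM2r //.
  rewrite -natr_sum ler_nat -big_mkcondr sum1_card (leq_trans _ (Tk t)) //.
  by apply: subset_leq_card; apply/subsetP => w; rewrite unfold_in => /andP[].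
rewrite -(ler_pM2r (divr_gt0 n0 (ltr0n _ 2))) ?(le_trans step) //.
apply: le_of_eq; field; exact: lt0r_neq0.
Qed.

(** The first moment: there are at most |Z0 :|: S|^2 pairs that could become
    adjacent, each with probability at most 2/n unless both vertices belong to
    Z0, whose positions are prescribed. *)
Lemma sum_defect S : (2 * (#|Z0| + 1) <= #|V|)%N -> [disjoint Z0 & S] ->
  \sum_(t : {perm V}) f0 t * (defect S t)%:R
    <= (#|Z0|%:R ^+ 2 + 2 * #|Z0 :|: S|%:R ^+ 2 / #|V|%:R
        + 2 * #|S|%:R * #|bad_positions|%:R / #|V|%:R) * \sum_(t : {perm V}) f0 t.
Proof.
move=> Zn dS; set N := \sum_t f0 t.
have N0 : 0 <= N by apply: sumr_ge0.
have Zn' : (2 * #|Z0| <= #|V|)%N by apply: leq_trans Zn; rewrite leq_mul2l leq_addr.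
have pair a b : \sum_(t : {perm V}) f0 t * (p (t a) == t b)%:R
    <= ((a \in Z0) && (b \in Z0))%:R * N + 2 / #|V|%:R * N.
  have pos : 0 <= 2 / #|V|%:R * N by rewrite mulr_ge0 // divr_ge0.
  case: (boolP (a \in Z0)) => aZ; case: (boolP (b \in Z0)) => bZ /=.
  - rewrite mul1r (le_trans _ (_ : N <= _)) ?lerDl //; apply: ler_sum => t _.
    by rewrite ler_piMr // lern1 leq_b1.
  - rewrite mul0r add0r.
    have := @fresh_hit Z0 b 1 f0 (fun t => [set p (t a)]) bZ Zn' f0_ge0 _ f0_local _.
    rewrite mulr1 => /(_ _ _); move=> h; apply: le_trans (h _ _).
    + by apply: ler_sum => t _; rewrite inE eq_sym.
    + by move=> t; rewrite cards1.
    + by move=> t t' e; rewrite e.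
  - rewrite mul0r add0r.
    have := @fresh_hit Z0 a 1 f0 (fun t => [set (p^-1)%g (t b)]) aZ Zn' f0_ge0 _ f0_local _.
    rewrite mulr1 => /(_ _ _); move=> h; apply: le_trans (h _ _).
    + apply: ler_sum => t _; rewrite inE ler_wpM2l // ler_nat.
      by case: eqP => // <-; rewrite permK eqxx.
    + by move=> t; rewrite cards1.
    + by move=> t t' e; rewrite e.
  rewrite mul0r add0r; case: (eqVneq a b) => [->|ab].
    by rewrite big1 // => t _; rewrite (negPf (p_neq _)) mulr0.
  have bZ' : b \notin a |: Z0 by rewrite !inE negb_or eq_sym ab.
  have Zn2 : (2 * #|a |: Z0| <= #|V|)%N.
    by rewrite cardsU1 aZ addnC.
  have loc t t' : {in a |: Z0, t =1 t'} -> f0 t = f0 t'.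
    by move=> e; apply: f0_local => z zZ; apply: e; rewrite inE zZ orbT.
  have := @fresh_hit (a |: Z0) b 1 f0 (fun t => [set p (t a)]) bZ' Zn2 f0_ge0 _ loc _.
  rewrite mulr1 => /(_ _ _); move=> h; apply: le_trans (h _ _).
  + by apply: ler_sum => t _; rewrite inE eq_sym.
  + by move=> t; rewrite cards1.
  + by move=> t t' e; rewrite e // setU11.
have mis a : a \in S -> \sum_(t : {perm V}) f0 t * (t a \in bad_positions)%:R
    <= 2 * #|bad_positions|%:R / #|V|%:R * N.
  move=> aS; apply: (@fresh_hit Z0 a _ f0 (fun=> bad_positions)) => //.
  by rewrite (disjointFl dS aS).
apply: (@le_trans _ _ (\sum_(a in Z0 :|: S) \sum_(b in Z0 :|: S)
      \sum_(t : {perm V}) f0 t * (p (t a) == t b)%:R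
    + \sum_(a in S) \sum_(t : {perm V}) f0 t * (t a \in bad_positions)%:R)).
  have -> : \sum_(a in Z0 :|: S) \sum_(b in Z0 :|: S)
        \sum_(t : {perm V}) f0 t * (p (t a) == t b)%:R
      = \sum_(t : {perm V}) \sum_(a in Z0 :|: S) \sum_(b in Z0 :|: S)
          f0 t * (p (t a) == t b)%:R.
    by rewrite [RHS]exchange_big; apply: eq_bigr => a _; rewrite exchange_big.
  rewrite [X in _ <= _ + X]exchange_big -big_split /=.
  apply: ler_sum => t _; rewrite /defect natrD mulrDr; apply: lerD.
    under eq_bigr do rewrite -mulr_sumr.
    rewrite -mulr_sumr ler_wpM2l // -sum1_card natr_sum big_mkcond /=.
    rewrite [leRHS]big_mkcond /=; apply: ler_sum => a _; rewrite inE.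
    case: (a \in Z0 :|: S) => //=; case: ifP => [/imsetP[b bZS eb]|_]; last first.
      by apply: sumr_ge0.
    by rewrite (bigD1 b) //= eb eqxx lerDl sumr_ge0.
  rewrite -mulr_sumr ler_wpM2l // -natr_sum ler_nat -big_mkcondr sum1_card.
  by apply: subset_leq_card; apply/subsetP => a; rewrite inE.
rewrite mulrDl; apply: lerD; last first.
  apply: le_trans (ler_sum _ mis) _; rewrite sumr_const -[leLHS]mulr_natl.
  by apply: le_of_eq; clear; move: (#|S|%:R) (#|bad_positions|%:R) (#|V|%:R^-1) N => a b c e; ring.
apply: (@le_trans _ _ (\sum_(a in Z0 :|: S) \sum_(b in Z0 :|: S)
  (((a \in Z0) && (b \in Z0))%:R * N + 2 / #|V|%:R * N))).
  by apply: ler_sum => a _; apply: ler_sum => b _; apply: pair.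
have cZ : \sum_(a in Z0 :|: S) (a \in Z0)%:R = #|Z0|%:R :> R.
  rewrite -natr_sum -big_mkcondr sum1_card; congr _%:R; apply: eq_card => a.
  by rewrite unfold_in !inE; case: (a \in Z0); rewrite ?andbF.
under eq_bigr do (rewrite big_split /= sumr_const -mulr_suml;
   under eq_bigr do rewrite -mulnb natrM; rewrite -mulr_sumr cZ).
rewrite big_split /= sumr_const -!mulr_suml cZ -mulrnA -[X in _ + X <= _]mulr_natr natrM.
apply: le_of_eq; clear.
by move: (#|Z0 :|: S|%:R) (#|Z0|%:R) (#|V|%:R^-1) N => a b c e; ring.
Qed.

(** The lower tail of the number of absorbers: the Markov inequality for the
    defect, and the exponential moment on the event that the defect is small. *)
Lemma few_absorbers T :
    (2 * (#|Z0| + 1) <= #|V|)%N -> [disjoint Z0 & A :|: B] -> (0 < y0)%N -> lam < 1 ->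
  \sum_(t : {perm V}) f0 t * (#|absorbers (A :|: B) t| < T)%N%:R
    <= ((#|Z0|%:R ^+ 2 + 2 * #|Z0 :|: (A :|: B)|%:R ^+ 2 / #|V|%:R
          + 2 * #|A :|: B|%:R * #|bad_positions|%:R / #|V|%:R) / y0%:R
        + expR (- lam' * ((#|A| * #|B|)%:R - #|A :&: B|%:R
                          - 2 * #|A :|: B|%:R * y0%:R) / #|V|%:R) / (1 - lam) ^+ T)
       * \sum_(t : {perm V}) f0 t.
Proof.
move=> Zn dS y00 lam1; set S := A :|: B.
have /andP[l0 _] := lam01.
have y0R : 0 < y0%:R :> R by rewrite ltr0n.
have pT : 0 < (1 - lam) ^+ T by rewrite exprn_gt0 // subr_gt0.
apply: (@le_trans _ _ (\sum_(t : {perm V})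
   (f0 t * (defect S t)%:R / y0%:R + penalty S t / (1 - lam) ^+ T))).
  apply: ler_sum => t _; case: (leqP (defect S t) y0) => [dy|dy].
    rewrite /penalty dy mulr1; case: ltnP => [xT|_]; last first.
      rewrite mulr0; apply: addr_ge0; apply: divr_ge0 => //;
        by rewrite ?(ltW pT) // mulr_ge0 // exprn_ge0 // subr_ge0 ltW.
    rewrite mulr1 -[leLHS]add0r; apply: lerD; first by rewrite divr_ge0 // mulr_ge0.
    rewrite -mulrA ler_peMr // ler_pdivlMr // mul1r.
    by apply: ler_wiXn2l; [rewrite subr_ge0 ltW|rewrite gerBl|apply: ltnW].
  rewrite -[leLHS]addr0; apply: lerD; last by rewrite divr_ge0 ?penalty_ge0 ?ltW.
  rewrite -mulrA ler_wpM2l //; apply: (@le_trans _ _ 1); first by rewrite lern1 leq_b1.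
  by rewrite ler_pdivlMr // mul1r ler_nat ltnW.
rewrite big_split /= -!mulr_suml mulrDl; apply: lerD.
  by rewrite [leRHS]mulrAC ler_wpM2r ?invr_ge0 ?(ltW y0R) //; apply: sum_defect.
rewrite [leRHS]mulrAC ler_wpM2r ?invr_ge0 ?(ltW pT) //.
apply: le_trans (sum_penalty dS) _; rewrite /pair_count.
have -> : A :&: S = A by apply/setIidPl/subsetUl.
have -> : B :&: S = B by apply/setIidPl/subsetUr.
have -> // : A :&: B :&: S = A :&: B.
by apply/setIidPl; apply: subset_trans (subsetIl _ _) (subsetUl _ _).
Qed.

End ShortCycles.

(** * Blocks, pool and the sequence of mergers *)

Section Assembly.
Variables (V : finType) (p : {perm V}) (K T : nat) (r0 : V).

Definition rep (C : {set V}) := odflt r0 [pick v in C].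
Definition orbit_index C := index C (enum (porbits p)).
(** The reserved vertices of C, and below those of the root cycle that are set
    aside for C. Taking every second vertex keeps a reserved vertex and its
    successor apart from the other reserved vertices and their successors. *)
Definition xblock (C : {set V}) (i : 'I_K) := (p ^+ (2 * i))%g (rep C).
Definition ublock C (j : 'I_K) := (p ^+ (2 * (orbit_index C * K + j)))%g r0.
Definition long (C : {set V}) := (2 * K <= #|C|)%N.
Definition long_orbits := [set C in porbits p | long C & C != porbit p r0].
Definition short_orbits := [set C in porbits p | ~~ long C].
Definition reserved :=
  [set xblock q.1 q.2 | q in setX long_orbits [set: 'I_K]]
  :|: [set ublock q.1 q.2 | q in setX long_orbits [set: 'I_K]].
(** The positions at which short cycles may be absorbed. As all of them are on
    long cycles, absorbing one short cycle never touches another one. *)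
Definition pool := [set w | long (porbit p w) & w \notin reserved].

Lemma porbit_rep C : C \in porbits p -> porbit p (rep C) = C.
Proof.
case/imsetP => v _ ->; rewrite /rep; case: pickP => [w wv|/(_ v)] /=.
  by apply/eqP; rewrite eq_porbit_mem.
by rewrite porbit_id.
Qed.

Lemma porbit_xblock C i : C \in porbits p -> porbit p (xblock C i) = C.
Proof. by move=> CP; rewrite porbit_perm porbit_rep. Qed.

Lemma porbit_ublock C j : porbit p (ublock C j) = porbit p r0.
Proof. exact: porbit_perm. Qed.

Lemma porbit1 v : porbit p (p v) = porbit p v.
Proof. exact: (porbit_perm p 1). Qed.

Lemma expg_perm_inj v a b : (a < #|porbit p v|)%N -> (b < #|porbit p v|)%N ->
  (p ^+ a)%g v = (p ^+ b)%g v -> a = b.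
Proof.
move=> av bv; rewrite !permX => e.
have /uniqP-/(_ v) inj := uniq_traject_porbit p v.
by apply: inj; rewrite ?inE ?size_traject // !nth_traject.
Qed.

Lemma long_orbitsW C : C \in long_orbits ->
  [/\ C \in porbits p, long C & C != porbit p r0].
Proof. by rewrite inE => /and3P. Qed.

Lemma card_vertices_in_orbits (P : pred {set V}) m :
    (forall C, C \in porbits p -> P C -> (#|C| <= m)%N) ->
  (#|[set w | P (porbit p w)]| <= #|[set C in porbits p | P C]| * m)%N.
Proof.
move=> Pm; rewrite -sum1_card -sum_nat_const.
rewrite (partition_big (porbit p) (mem [set C in porbits p | P C])) /=; last first.
  by move=> w; rewrite !inE imset_f.
apply: leq_sum => C; rewrite inE => /andP[CP PC]; rewrite sum1_card.
apply: leq_trans (Pm C CP PC); apply: subset_leq_card; apply/subsetP => w.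
by rewrite unfold_in => /andP[_ /eqP <-]; apply: porbit_id.
Qed.

Lemma xblock_lt C (i : 'I_K) : C \in long_orbits -> ((2 * i).+1 < #|porbit p (rep C)|)%N.
Proof.
rewrite inE => /and3P[CP CL _]; rewrite porbit_rep //; apply: leq_trans CL.
have := ltn_ord i; lia.
Qed.

Lemma xblock_inj C : C \in long_orbits -> injective (xblock C).
Proof.
move=> CL i j /expg_perm_inj e; apply: val_inj => /=.
by have := e (ltnW (xblock_lt i CL)) (ltnW (xblock_lt j CL)); lia.
Qed.

Lemma p_xblock_neq C i j : C \in long_orbits -> p (xblock C i) != xblock C j.
Proof.
move=> CL; apply/eqP; rewrite /xblock -permM -expgSr => /expg_perm_inj e.
by have := e (xblock_lt i CL) (ltnW (xblock_lt j CL)); lia.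
Qed.

Hypothesis T_gt0 : (0 < T)%N.
Hypothesis orbits_le : (#|porbits p| <= T)%N.
Hypothesis root_big : (2 * (T * K) <= #|porbit p r0|)%N.

Lemma orbit_index_lt C : C \in porbits p -> (orbit_index C < T)%N.
Proof.
by move=> CP; apply: leq_trans orbits_le; rewrite cardE index_mem mem_enum.
Qed.

Lemma ublock_lt C (j : 'I_K) : C \in porbits p ->
  ((2 * (orbit_index C * K + j)).+1 < #|porbit p r0|)%N.
Proof.
move=> /orbit_index_lt ci; apply: leq_trans root_big.
have : (orbit_index C * K + j < T * K)%N.
  apply: (@leq_trans ((orbit_index C).+1 * K)); last by rewrite leq_mul2r ci orbT.
  by rewrite mulSn addnC ltn_add2r.
lia.
Qed.

Lemma ublock_inj C C' j j' : C \in porbits p -> C' \in porbits p ->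
  ublock C j = ublock C' j' -> C = C' /\ j = j'.
Proof.
move=> CP CP' /expg_perm_inj e.
have {}e : (orbit_index C * K + j = orbit_index C' * K + j')%N.
  by have := e (ltnW (ublock_lt j CP)) (ltnW (ublock_lt j' CP')); lia.
have K0 : (0 < K)%N by apply: leq_trans (ltn_ord j).
have ej : j = j' :> nat.
  have := congr1 (fun a => a %% K)%N e.
  by rewrite /= !modnMDl !modn_small.
split; last exact: val_inj.
have : (orbit_index C * K = orbit_index C' * K)%N by lia.
move/eqP; rewrite eqn_mul2r eqn0Ngt K0 /= => /eqP ei.
have CE D : D \in porbits p -> nth set0 (enum (porbits p)) (orbit_index D) = D.
  by move=> DP; rewrite nth_index // mem_enum.
by rewrite -(CE _ CP) ei CE.
Qed.

Lemma root_long : long (porbit p r0).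
Proof.
apply: leq_trans root_big; rewrite leq_mul2l /=.
by rewrite -{1}[K]mul1n leq_mul2r T_gt0 orbT.
Qed.

Lemma reserved_long w : w \in reserved -> long (porbit p w).
Proof.
rewrite inE => /orP[] /imsetP[[C i]]; rewrite in_setX /= => /andP[CL _] ->.
  by have [CP lC _] := long_orbitsW CL; rewrite porbit_xblock.
by rewrite porbit_ublock root_long.
Qed.

Lemma card_reserved : (#|reserved| <= 2 * (T * K))%N.
Proof.
have c (f : {set V} * 'I_K -> V) :
    (#|[set f q | q in setX long_orbits [set: 'I_K]]| <= T * K)%N.
  apply: leq_trans (leq_imset_card _ _) _; rewrite cardsX cardsT card_ord.
  rewrite leq_mul2r; apply/orP; right; apply: leq_trans orbits_le.
  by apply: subset_leq_card; apply/subsetP => C /long_orbitsW[].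
by rewrite mul2n -addnn; apply: leq_trans (leq_card_setU _ _) (leq_add (c _) (c _)).
Qed.

Lemma card_poolC : (#|~: pool| <= 4 * (T * K))%N.
Proof.
have sub : ~: pool \subset [set w | ~~ long (porbit p w)] :|: reserved.
  by apply/subsetP => w; rewrite in_setC in_set negb_and negbK in_setU in_set.
apply: leq_trans (subset_leq_card sub) _; apply: leq_trans (leq_card_setU _ _) _.
have h := @card_vertices_in_orbits (fun C => ~~ long C) (2 * K) _.
apply: leq_trans (leq_add (h _) card_reserved) _.
  by move=> C _; rewrite /long -ltnNge => /ltnW.
have : (#|[set C in porbits p | ~~ long C]| <= T)%N.
  apply: leq_trans orbits_le; apply: subset_leq_card.
  by apply/subsetP => C; rewrite inE => /andP[].
move=> sT; apply: (@leq_trans (T * (2 * K) + 2 * (T * K))); last lia.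
by rewrite leq_add2r leq_mul2r sT orbT.
Qed.

Lemma card_bad_positions : (#|bad_positions p pool| <= 8 * (T * K))%N.
Proof.
have sub : bad_positions p pool \subset ~: pool :|: [set p w | w in ~: pool].
  apply/subsetP => w; rewrite in_set => /orP[h|h]; rewrite in_setU in_setC ?h //.
  by apply/orP; right; apply/imsetP; exists ((p^-1)%g w); rewrite ?in_setC ?permKV.
apply: leq_trans (subset_leq_card sub) _; apply: leq_trans (leq_card_setU _ _) _.
rewrite (card_imset _ (@perm_inj _ p)).
by apply: leq_trans (leq_add card_poolC card_poolC) _; lia.
Qed.

Variable g : rel V.

Definition long_linked :=
  [forall C in long_orbits, exists i : 'I_K, exists j : 'I_K,
     g (xblock C i) (p (ublock C j)) && g (ublock C j) (p (xblock C i))].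

Definition short_absorbers (x : V) :=
  [set u in pool | g x (p u) && g u (p x)].

Definition short_linked :=
  [forall C in short_orbits, (T <= #|short_absorbers (rep C)|)%N].

(** A long cycle C is untouched when its turn comes, because earlier mergers
    changed other long cycles and blocks of the root cycle set aside for
    those. *)
Lemma merge_long (l : seq {set V}) : long_linked -> uniq l ->
    {subset l <= long_orbits} ->
  exists2 D, merged g p D (size l) &
    forall w, w \in D ->
      exists C, C \in l /\ exists i, w = xblock C i \/ w = ublock C i.
Proof.
move=> /forall_inP link; elim: l => [|C l IH] /=.
  by exists set0; [apply: merged0|move=> w; rewrite inE].
case/andP => Cl ul sub; have [|D mD DP] := IH ul.
  by move=> C' Cl'; apply: sub; rewrite inE Cl' orbT.
have CL : C \in long_orbits by apply: sub; rewrite mem_head.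
have lL C' : C' \in l -> C' \in long_orbits by move=> h; apply: sub; rewrite inE h orbT.
have [CP lC Cr] := long_orbitsW CL.
have /existsP[i /existsP[j /andP[gxu gux]]] := link C CL.
exists (xblock C i |: (ublock C j |: D)); last first.
  move=> w; rewrite !inE => /or3P[/eqP->|/eqP->|/DP[C' [C'l [i' ei']]]].
  - by exists C; rewrite mem_head; split=> //; exists i; left.
  - by exists C; rewrite mem_head; split=> //; exists j; right.
  - by exists C'; rewrite inE C'l orbT; split=> //; exists i'.
apply: mergedS => //.
- rewrite porbit_xblock // disjoint_subset; apply/subsetP => w wC.
  rewrite inE; apply/negP => /DP[C' [C'l [i' ei']]].
  have [CP' _ Cr'] := long_orbitsW (lL _ C'l).
  have wC' : porbit p w = C by apply/eqP; rewrite -(porbit_rep CP) eq_porbit_mem (porbit_rep CP).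
  case: ei' => ei'; move: wC'; rewrite ei' ?porbit_xblock ?porbit_ublock // => eC.
    by rewrite -eC C'l in Cl.
  by rewrite eC eqxx in Cr.
- apply/negP => /DP[C' [C'l [i' ei']]].
  have [CP' _ Cr'] := long_orbitsW (lL _ C'l).
  case: ei' => [ei'|/(ublock_inj CP CP')[eC _]]; last by rewrite eC C'l in Cl.
  have := congr1 (porbit p) ei'; rewrite porbit_ublock porbit_xblock // => eC.
  by rewrite eC eqxx in Cr'.
- rewrite -eq_porbit_mem porbit_ublock porbit_xblock // eq_sym.
  exact: Cr.
Qed.

(** Every merger spoils only one vertex of the pool, so with T absorbers for each
    of at most T cycles the greedy choice succeeds. *)
Lemma merge_short D0 k0 (l : seq {set V}) : short_linked -> uniq l ->
    {subset l <= short_orbits} -> merged g p D0 k0 ->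
    D0 \subset reserved ->
  exists2 D, merged g p D (k0 + size l) &
    (forall w, w \in D -> [\/ w \in reserved, w \in pool | porbit p w \in l])
    /\ (#|D :&: pool| <= size l)%N.
Proof.
move=> /forall_inP link ul sub m0 D0r; elim: l ul sub => [|C l IH] /=.
  move=> _ _; exists D0; rewrite ?addn0 //; split.
    by move=> w wD; apply: Or31; apply: (subsetP D0r).
  rewrite leqn0 cards_eq0 -subset0; apply/subsetP => w.
  by rewrite in_setI in_set => /and3P[/(subsetP D0r) ->].
case/andP => Cl ul sub; have [|D mD [DP cD]] := IH ul.
  by move=> C' Cl'; apply: sub; rewrite inE Cl' orbT.
have CS : C \in short_orbits by apply: sub; rewrite mem_head.
have [CP sC] : C \in porbits p /\ ~~ long C by move: CS; rewrite inE => /andP.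
have lT : (size l < T)%N.
  have ul' : uniq (C :: l) by rewrite /= Cl.
  rewrite -[(size l).+1]/(size (C :: l)) -(card_uniqP ul').
  apply: leq_trans orbits_le; apply: subset_leq_card; apply/subsetP => C' /sub.
  by rewrite inE => /andP[].
have [u uA uD] : exists2 u, u \in short_absorbers (rep C) & u \notin D.
  apply/subsetPn; apply: contraL (link C CS) => sA; rewrite -ltnNge.
  apply: leq_ltn_trans (leq_ltn_trans cD lT); apply: subset_leq_card.
  apply/subsetP => u uA; rewrite inE (subsetP sA) //=.
  by move: uA; rewrite inE => /andP[].
have [uU gxu gux] : [/\ u \in pool, g (rep C) (p u) & g u (p (rep C))].
  by move: uA; rewrite inE => /and3P.
have ulong : long (porbit p u) by move: uU; rewrite inE => /andP[].
have xNU : rep C \notin pool by rewrite inE porbit_rep // (negPf sC).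
have porbC w : w \in C -> porbit p w = C.
  by move=> wC; apply/eqP; rewrite -(porbit_rep CP) eq_porbit_mem (porbit_rep CP).
exists (rep C |: (u |: D)); last split.
- rewrite addnS; apply: mergedS => //.
    rewrite porbit_rep // disjoint_subset; apply/subsetP => w wC.
    rewrite inE; apply/negP => /DP; case.
    + by move/reserved_long; rewrite porbC // (negPf sC).
    + by rewrite inE porbC // (negPf sC).
    + by rewrite porbC // (negPf Cl).
  rewrite porbit_rep //; apply/negP => /porbC uC.
  by rewrite uC (negPf sC) in ulong.
- move=> w; rewrite !in_setU1 => /or3P[/eqP->|/eqP->|/DP[]h].
  + by apply: Or33; rewrite porbit_rep // mem_head.
  + by apply: Or32.
  + by apply: Or31.
  + by apply: Or32.
  + by apply: Or33; rewrite inE h orbT.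
- have sub' : (rep C |: (u |: D)) :&: pool \subset u |: (D :&: pool).
    apply/subsetP => w; rewrite in_setI => /andP[]; rewrite !in_setU1 in_setI.
    case/or3P => [/eqP->|->|->] //; first by rewrite (negPf xNU).
    by move=> ->; rewrite orbT.
  apply: leq_trans (subset_leq_card sub') _; rewrite cardsU1.
  by apply: (leq_add (leq_b1 _)).
Qed.

Lemma linked_merged : long_linked -> short_linked ->
  exists D, merged g p D #|porbits p|.-1.
Proof.
move=> lk sk.
have [|D1 m1 D1P] := merge_long lk (enum_uniq (mem long_orbits)).
  by move=> C; rewrite mem_enum.
have [||D2 m2 _] := merge_short sk (enum_uniq (mem short_orbits)) _ m1 _.
- by move=> C; rewrite mem_enum.
- apply/subsetP => w /D1P[C [Cl [i ei]]]; rewrite mem_enum in Cl.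
  rewrite inE; apply/orP; case: ei => ->; [left|right]; apply/imsetP;
    by exists (C, i); rewrite // in_setX Cl inE.
exists D2; move: m2; rewrite -!cardE.
suff -> : (#|porbits p|.-1 = #|long_orbits| + #|short_orbits|)%N by [].
rewrite (cardsD1 (porbit p r0)) imset_f //= -cardsUI.
have -> : long_orbits :&: short_orbits = set0.
  by apply/setP => C; rewrite !inE; case: (long C); rewrite ?andbF.
rewrite cards0 addn0; apply: eq_card => C; rewrite !inE.
case: (eqVneq C (porbit p r0)) => [->|] /=; first by rewrite root_long !andbF.
by case: (C \in porbits p); case: (long C).
Qed.

End Assembly.

(** * The failure probability for a fixed cycle type *)

Lemma one_minus_ratio_ge0 (R : realFieldType) (a b : nat) :
  (a <= b)%N -> 0 <= 1 - a%:R / (2 * b%:R) :> R.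
Proof.
move=> ab; rewrite subr_ge0; case: (posnP b) => [->|b0].
  by rewrite mulr0 invr0 mulr0.
rewrite ler_pdivrMr ?mul1r; last by rewrite -natrM ltr0n muln_gt0.
by rewrite -natrM ler_nat (leq_trans ab) // leq_pmull.
Qed.

(** The bound of [few_absorbers] in terms of the parameters: the first summand
    bounds the probability of a large defect, the second one that of few
    absorbers while the defect is small. *)
Definition short_fail (R : realType) (n T K k y0 : nat) (lam : R) : R :=
  (4 + 2 * (2 * k%:R + 2) ^+ 2 / n%:R + 32 * k%:R * (T * K)%:R / n%:R) / y0%:R
  + expR (- (lam * (1 - lam / 2)) * (k%:R ^+ 2 - k%:R - 4 * k%:R * y0%:R) / n%:R)
    / (1 - lam) ^+ T.

Lemma short_fail_ge0 (R : realType) n T K k y0 (lam : R) : 0 <= lam < 1 ->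
  0 <= short_fail n T K k y0 lam.
Proof.
move=> /andP[l0 l1]; have l2 : 0 <= 1 - lam by rewrite subr_ge0 ltW.
apply: addr_ge0; last by rewrite divr_ge0 ?expR_ge0 ?exprn_ge0.
exact: divr_ge0.
Qed.

Section FixedCycleType.
Variables (R : realType) (V : finType) (G : sgraph V) (p : {perm V}).
Variables (T K k y0 : nat) (lam : R).
Hypothesis p3 : no_short_cycle [set: V] p.
Hypothesis T_gt0 : (0 < T)%N.
Hypothesis orbits_le : (#|porbits p| <= T)%N.
Hypothesis deg_gt : forall v, (k < degree G v)%N.
Hypothesis Kk : (8 * K <= k)%N.
Hypothesis V_big : (2 * (T * K) * T <= #|V|)%N.
Hypothesis V6 : (6 <= #|V|)%N.
Hypothesis y0_gt0 : (0 < y0)%N.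
Hypothesis lam01 : 0 <= lam < 1.

(** By the pigeonhole principle, the largest cycle offers room for T disjoint
    blocks. *)
Lemma exists_big_orbit : exists r0, (2 * (T * K) <= #|porbit p r0|)%N.
Proof.
case: (boolP [exists r0, (2 * (T * K) <= #|porbit p r0|)%N]) => [/existsP//|].
rewrite negb_exists => /forallP small; exfalso.
have := @card_vertices_in_orbits _ p predT (2 * (T * K)).-1 _.
have -> : [set w | predT (porbit p w)] = [set: V] by apply/setP => w; rewrite !inE.
have -> : [set C in porbits p | predT C] = porbits p.
  by apply/setP => C; rewrite inE andbT.
rewrite cardsT => h.
have {}h : (#|V| <= #|porbits p| * (2 * (T * K)).-1)%N.
  apply: h => _ /imsetP[v _ ->] _; have := small v; rewrite -ltnNge.
  by case: (2 * (T * K))%N.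
have [v _] : exists v : V, v \in V by apply/card_gt0P; apply: leq_trans V6.
have M0 : (0 < 2 * (T * K))%N.
  by apply: leq_trans (_ : #|porbit p v|.+1 <= _)%N; rewrite // ltnNge small.
have : (#|V| <= T * (2 * (T * K)).-1)%N.
  by apply: leq_trans h _; rewrite leq_mul2r orbits_le orbT.
move: V_big V6 M0; set M := (2 * (T * K))%N; set n := #|V|.
by move: M n => [//|M] n /= h1 h2 _; rewrite mulSn in h1; lia.
Qed.

Let q : R := k%:R / (2 * #|V|%:R).
Let short_fail_V := short_fail #|V| T K k y0 lam.

(** Condition on the vertices a and b placed at x and p x, and choose A in the
    neighbourhood of b and B in that of a, of size k each. *)
Lemma short_absorbers_fail r0 x : (2 * (T * K) <= #|porbit p r0|)%N ->
  \sum_(s : {perm V})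
     (#|short_absorbers p K r0 (relabel_adj G s) x| < T)%N%:R
  <= short_fail_V * #|{perm V}|%:R.
Proof.
move=> root_big; have /andP[l0 l1] := lam01.
have lam01' : 0 <= lam <= 1 by rewrite l0 ltW.
have p_neq w : p w != w by have [] := no_short_cycleP _ p3 w.
pose f a b (t : {perm V}) : R := ((t a == x) && (t b == p x))%:R.
have f_sum (t : {perm V}) : \sum_a \sum_b f a b t = 1.
  rewrite (bigD1 ((t^-1)%g x)) //= [X in _ + X]big1 ?addr0 => [|a ax].
    rewrite (bigD1 ((t^-1)%g (p x))) //= [X in _ + X]big1 ?addr0 => [|b bx].
      by rewrite /f !permKV !eqxx.
    rewrite /f permKV eqxx; case: eqP => // e.
    by rewrite -e permK eqxx in bx.
  rewrite big1 // => b _; rewrite /f; case: eqP => // e.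
  by rewrite -e permK eqxx in ax.
have sumf (F : {perm V} -> R) :
    \sum_t F t = \sum_a \sum_b \sum_t f a b t * F t.
  under [RHS]eq_bigr do rewrite exchange_big /=.
  rewrite exchange_big /=; apply: eq_bigr => t _.
  by under eq_bigr do rewrite -mulr_suml; rewrite -mulr_suml f_sum mul1r.
have -> : #|{perm V}|%:R = \sum_a \sum_b \sum_t f a b t :> R.
  transitivity (\sum_(t : {perm V}) (1 : R)); first by rewrite sumr_const.
  rewrite (sumf (fun=> 1)); apply: eq_bigr => a _; apply: eq_bigr => b _.
  by apply: eq_bigr => t _; rewrite mulr1.
rewrite (reindex_inj invg_inj) /= (sumf _) mulr_sumr; apply: ler_sum => a _.
rewrite mulr_sumr; apply: ler_sum => b _.
have [ab|ab] := eqVneq a b.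
  have fz t : f a b t = 0.
    rewrite /f ab; case: eqP => //= ->.
    by rewrite eq_sym (negPf (p_neq _)).
  by rewrite big1 => [|t _]; rewrite ?fz ?mul0r // big1 ?mulr0.
pose nbr v := [set w | adj G v w].
have nbr_notin v : v \notin nbr v.
  by rewrite inE; apply/negP => /adj_neq; rewrite eqxx.
have choose v w : exists2 B : {set V}, B \subset nbr v :\ w & #|B| = k.
  apply: exists_subset_card; have := deg_gt v; rewrite /degree -/(nbr v).
  rewrite (cardsD1 w) => h; rewrite -ltnS; apply: leq_trans h _.
  by rewrite -add1n leq_add2r leq_b1.
have [A sA cA] := choose b a; have [B sB cB] := choose a b.
have f0 t : 0 <= f a b t by [].
have floc (t t' : {perm V}) : {in [set a; b], t =1 t'} -> f a b t = f a b t'.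
  by move=> e; rewrite /f !e // !inE eqxx ?orbT.
have dis : [disjoint [set a; b] & A :|: B].
  rewrite disjoint_sym disjoint_subset; apply/subsetP => w; rewrite !inE negb_or.
  case/orP => [/(subsetP sA)|/(subsetP sB)]; rewrite !inE => /andP[-> /=].
    by apply: contraTneq => ->; apply/negP => /adj_neq; rewrite eqxx.
  by move=> aw; rewrite andbT; apply: contraTneq aw => ->;
     apply/negP => /adj_neq; rewrite eqxx.
have cab : #|[set a; b]| = 2 by rewrite cards2 ab.
have few := @few_absorbers V R p p_neq (pool p K r0) [set a; b] A B (f a b) lam y0
  f0 floc lam01' T _ dis y0_gt0 l1.
apply: (@le_trans _ _ (\sum_t f a b t *
    (#|absorbers p (pool p K r0) A B (A :|: B) t| < T)%N%:R)).
  apply: ler_sum => t _; rewrite /f; case: eqP => [ta|]; rewrite ?mul0r //.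
  case: eqP => [tb|]; rewrite ?mul0r // !mul1r ler_nat.
  suff : (#|absorbers p (pool p K r0) A B (A :|: B) t|
      <= #|short_absorbers p K r0 (relabel_adj G t^-1) x|)%N.
    by move=> h; case: ltnP => // h'; rewrite (leq_ltn_trans h h').
  rewrite -(card_imset _ (@perm_inj _ t)); apply: subset_leq_card.
  apply/subsetP => _ /imsetP[w wA ->].
  move: wA; rewrite in_set => /and3P[wA wU /imsetP[w' wB' ew']].
  rewrite in_set wU /= /relabel_adj ew' -tb -ta !permK.
  have wa : w \in A by move: wA; rewrite inE => /andP[].
  have wb : w' \in B by move: wB'; rewrite inE => /andP[].
  have := subsetP sA _ wa; have := subsetP sB _ wb; rewrite !inE.
  by move=> /andP[_ ->] /andP[_]; rewrite adjC => ->.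
apply: le_trans (few _) _; first by rewrite cab.
apply: ler_wpM2r; first by apply: sumr_ge0 => t _; apply: f0.
have n0 : 0 < #|V|%:R :> R by rewrite ltr0n (leq_trans _ V6).
have cS : (#|A :|: B| <= 2 * k)%N.
  by apply: leq_trans (leq_card_setU _ _) _; rewrite cA cB mul2n addnn.
have cS2 : (#|[set a; b] :|: (A :|: B)| <= 2 * k + 2)%N.
  by apply: leq_trans (leq_card_setU _ _) _; rewrite cab addnC leq_add2r.
have cI : (#|A :&: B| <= k)%N by rewrite -cA subset_leq_card // subsetIl.
have cbad := card_bad_positions T_gt0 orbits_le root_big.
have cSR : #|A :|: B|%:R <= 2 * k%:R :> R by rewrite -natrM ler_nat.
have cS2R : #|[set a; b] :|: (A :|: B)|%:R <= 2 * k%:R + 2 :> R.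
  by rewrite -natrM -natrD ler_nat.
have cIR : #|A :&: B|%:R <= k%:R :> R by rewrite ler_nat.
have cbadR : #|bad_positions p (pool p K r0)|%:R <= 8 * (T * K)%:R :> R.
  by rewrite -natrM ler_nat.
have y0R : 0 <= y0%:R^-1 :> R by rewrite invr_ge0.
have pT : 0 <= ((1 - lam) ^+ T)^-1 by rewrite invr_ge0 exprn_ge0 // subr_ge0 ltW.
have nV : 0 <= #|V|%:R^-1 :> R by rewrite invr_ge0 ltW.
rewrite /short_fail_V /short_fail cA cB cab natrM; apply: lerD.
  apply: ler_wpM2r => //; apply: lerD; first apply: lerD.
  - by rewrite -natrX.
  - apply: ler_wpM2r => //; apply: ler_wpM2l => //.
    by apply: lerXn2r; rewrite ?nnegrE.
  - apply: ler_wpM2r => //.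
    apply: (@le_trans _ _ (2 * (2 * k%:R) * (8 * (T * K)%:R))).
      by apply: ler_pM => //; rewrite ?mulr_ge0 // ler_wpM2l.
    move: (k%:R : R) ((T * K)%:R : R) => c e.
    by apply: le_of_eq; ring.
apply: ler_wpM2r => //; rewrite ler_expR; apply: ler_wpM2r => //.
have l'0 : 0 <= lam * (1 - lam / 2).
  apply: mulr_ge0 => //; rewrite subr_ge0 ler_pdivrMr // mul1r.
  by apply: le_trans (ltW l1) _; rewrite ler1n.
rewrite !mulNr lerN2; apply: ler_wpM2l => //.
rewrite -expr2; apply: lerB; first by apply: lerB.
apply: ler_wpM2r => //; move: cSR; move: (#|A :|: B|%:R : R) (k%:R : R) => c e h.
by lra.
Qed.

(** The union bound over the long and the short cycles. *)
Lemma not_hamiltonian_le :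
  \sum_(s : {perm V}) (~~ hamiltonian (gunion G (permgraph (p ^ s)%g)))%:R
  <= T%:R * (short_fail_V + 3 * (1 - q) ^+ K./2) * #|{perm V}|%:R.
Proof.
have [r0 root_big] := exists_big_orbit.
pose lfail C (s : {perm V}) := [forall i : 'I_K, forall j : 'I_K,
  ~~ (adj G (s (xblock p r0 C i)) (s (p (ublock p r0 C j)))
      && adj G (s (ublock p r0 C j)) (s (p (xblock p r0 C i))))].
pose sfail C s :=
  (#|short_absorbers p K r0 (relabel_adj G s) (rep r0 C)| < T)%N.
have pointwise s : (~~ hamiltonian (gunion G (permgraph (p ^ s)%g)))%:R
    <= \sum_(C in long_orbits p K r0) (lfail C s)%:R
       + \sum_(C in short_orbits p K) (sfail C s)%:R :> R.
  case: (boolP [exists C in long_orbits p K r0, lfail C s]) => [/exists_inP[C CL CF]|].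
    rewrite (bigD1 C) //= CF -addrA; apply: (@le_trans _ _ 1).
      by rewrite lern1 leq_b1.
    by rewrite lerDl addr_ge0 // sumr_ge0.
  case: (boolP [exists C in short_orbits p K, sfail C s]) => [/exists_inP[C CL CF] _|].
    rewrite [X in _ <= _ + X](bigD1 C) //= CF addrCA; apply: (@le_trans _ _ 1).
      by rewrite lern1 leq_b1.
    by rewrite lerDl addr_ge0 // sumr_ge0.
  move=> noS noL; rewrite negb_exists_in in noS; rewrite negb_exists_in in noL.
  move/forall_inP: noS => noS; move/forall_inP: noL => noL.
  suff -> : hamiltonian (gunion G (permgraph (p ^ s)%g)).
    by rewrite addr_ge0 // sumr_ge0.
  have lk : long_linked p K r0 (relabel_adj G s).
    apply/forall_inP => C CL; have := noL C CL; rewrite negb_forall.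
    case/existsP => i; rewrite negb_forall => /existsP[j]; rewrite negbK => h.
    by apply/existsP; exists i; apply/existsP; exists j.
  have sk : short_linked p K T r0 (relabel_adj G s).
    by apply/forall_inP => C CS; rewrite leqNgt; apply: noS.
  have [D mD] := linked_merged T_gt0 orbits_le root_big lk sk.
  apply: hamiltonian_merged mD _ => //; first by apply: leq_trans V6.
  by rewrite prednK //; apply/card_gt0P; exists (porbit p r0); apply: imset_f.
apply: le_trans (ler_sum _ (fun s _ => pointwise s)) _.
rewrite big_split /= exchange_big [X in _ + X]exchange_big /=.
have long_fail C : C \in long_orbits p K r0 ->
    \sum_s (lfail C s)%:R <= 3 * (1 - q) ^+ K./2 * #|{perm V}|%:R.
  move=> CL; have [CP lC Cr] := long_orbitsW CL.
  have px_orb i : porbit p (p (xblock p r0 C i)) = C.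
    by rewrite porbit1 porbit_xblock.
  have pu_orb j : porbit p (p (ublock p r0 C j)) = porbit p r0.
    by rewrite porbit1 porbit_ublock.
  apply: (@cross_edges_fail V R k (adj G) _ K (xblock p r0 C)
    (fun i => p (xblock p r0 C i)) (ublock p r0 C)
    (fun j => p (ublock p r0 C j))) => //.
  - by move=> v; apply: ltnW; apply: deg_gt.
  - by move=> j j' /perm_inj /(ublock_inj T_gt0 orbits_le root_big CP CP) [].
  - by move=> i i' /perm_inj /(xblock_inj CL).
  - move=> i j; apply/eqP => /(congr1 (porbit p)).
    by rewrite pu_orb porbit_xblock // => e; rewrite e eqxx in Cr.
  - move=> i j; split.
    + exact: p_xblock_neq.
    + apply/eqP => /(congr1 (porbit p)); rewrite px_orb porbit_ublock => e.
      by rewrite -e eqxx in Cr.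
    + apply/eqP => /(congr1 (porbit p)); rewrite px_orb pu_orb => e.
      by rewrite -e eqxx in Cr.
have sfail_le C : C \in short_orbits p K ->
    \sum_s (sfail C s)%:R <= short_fail_V * #|{perm V}|%:R.
  by move=> _; apply: short_absorbers_fail.
apply: le_trans (lerD (ler_sum _ long_fail) (ler_sum _ sfail_le)) _.
have cl : (#|long_orbits p K r0| <= T)%N.
  apply: leq_trans orbits_le; apply: subset_leq_card.
  by apply/subsetP => C /long_orbitsW[].
have cs : (#|short_orbits p K| <= T)%N.
  apply: leq_trans orbits_le; apply: subset_leq_card.
  by apply/subsetP => C; rewrite inE => /andP[].
have sf0 : 0 <= short_fail_V by apply: short_fail_ge0.
have q1 : 0 <= 1 - q.
  apply: one_minus_ratio_ge0.
  by apply: leq_trans (ltnW (deg_gt r0)) _; apply: max_card.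
rewrite !sumr_const -[X in X + _ <= _]mulr_natl -[X in _ + X <= _]mulr_natl.
rewrite -[leRHS]mulrA [X in _ <= _ * X]mulrDl [leRHS]mulrDr [leRHS]addrC.
apply: lerD; apply: ler_wpM2r.
- by rewrite mulr_ge0 // mulr_ge0 // exprn_ge0.
- by rewrite ler_nat.
- by rewrite mulr_ge0.
- by rewrite ler_nat.
Qed.

End FixedCycleType.

(** * Averaging over the cycle type *)

Definition many_cycles_bound (R : realType) (n T : nat) (zeta : R) : R :=
  5 / 2 * expR (zeta / 2 * (3 + ln n%:R)) / (1 + zeta) ^+ T.+1.

Section FailureProbability.
Variables (R : realType) (V : finType).
Implicit Types (F G : sgraph V) (p s : {perm V}).

Let n := #|V|.

Lemma card_regular_graphs :
  #|regular_graphs V 2|%:R = nsc_weight R [set: V].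
Proof.
transitivity (\sum_(F in regular_graphs V 2) (1 : R)); first by rewrite sumr_const.
rewrite sum_regular_graphs; apply: eq_bigr => p _; exact: mulr1.
Qed.

Lemma card_regular_graphs_lower : (3 <= n)%N ->
  2 / 5 * \prod_(i < n) (2^-1 + i%:R) <= #|regular_graphs V 2|%:R :> R.
Proof.
move=> n3; rewrite card_regular_graphs.
have := nsc_weight_lower R (cardsT V); rewrite subnn expr0 mul1r; apply: le_trans.
by rewrite -/n; move: n3; case: n => [|[|[|m]]] // _; apply: ewens_lower_le.
Qed.

(** The factors of the quotient are 1 + zeta / (2 i + 1), and the sum of the
    1 / (2 i + 1) is (log m) / 2 up to a constant. *)
Lemma prod_ratio_le (zeta : R) m : 0 <= zeta ->
  \prod_(i < m.+2) ((1 + zeta) / 2 + i%:R)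
    <= expR (zeta / 2 * (3 + ln m.+1%:R)) * \prod_(i < m.+2) (2^-1 + i%:R).
Proof.
move=> z0; elim: m => [|m IH].
  rewrite ln1 addr0 !big_ord_recl !big_ord0 /= !mulr1 addr0 addr0.
  have -> : expR (zeta / 2 * 3) = expR zeta * expR (zeta / 2).
    by rewrite -expRD; congr expR; field.
  have e1 := expR_ge1Dx zeta; have e2 := expR_ge1Dx (zeta / 2).
  apply: (@le_trans _ _ ((1 + zeta) * (1 + zeta / 2) * (2^-1 * (2^-1 + 1)))).
    by rewrite /bump /= addn0; nra.
  rewrite /bump /= addn0 ler_wpM2r //.
  by apply: ler_pM => //; rewrite addr_ge0 // divr_ge0.
rewrite big_ord_recr [in leRHS]big_ord_recr /= mulrA.
have step : (1 + zeta) / 2 + m.+2%:R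
    <= expR (zeta / 2 * (ln m.+2%:R - ln m.+1%:R)) * (2^-1 + m.+2%:R).
  have m0 : 0 < (m.+2%:R : R) by rewrite ltr0n.
  have lnm : m.+2%:R^-1 <= ln m.+2%:R - ln m.+1%:R :> R.
    rewrite -lerN2 opprB -ln_div ?posrE ?ltr0n //.
    have -> : m.+1%:R / m.+2%:R = 1 + - m.+2%:R^-1 :> R.
      by rewrite -[m.+2]addn1 natrD; field; rewrite gt_eqF // -(natrD _ _ 1) ltr0n addn1.
    by apply: le_ln1Dx; rewrite ltrN2 invf_lt1 // ltr1n.
  apply: (@le_trans _ _ ((1 + zeta / 2 * m.+2%:R^-1) * (2^-1 + m.+2%:R))).
    move: m0; move: (m.+2%:R : R) => a a0; rewrite -subr_ge0.
    have -> : (1 + zeta / 2 * a^-1) * (2^-1 + a) - ((1 + zeta) / 2 + a) = zeta / (4 * a).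
      by field; rewrite gt_eqF.
    by rewrite divr_ge0 // mulr_ge0 // ltW.
  apply: ler_wpM2r; first by rewrite addr_ge0 // invr_ge0.
  apply: le_trans (expR_ge1Dx _) _.
  by rewrite ler_expR; apply: ler_wpM2l => //; rewrite divr_ge0.
have P0 : 0 <= \prod_(i < m.+2) (2^-1 + i%:R) :> R.
  by apply: prodr_ge0 => i _; rewrite addr_ge0 // invr_ge0.
apply: le_trans (ler_pM _ _ IH step) _.
- by apply: prodr_ge0 => i _; rewrite addr_ge0 // divr_ge0 // addr_ge0.
- by rewrite addr_ge0 // divr_ge0 // addr_ge0.
have -> : expR (zeta / 2 * (3 + ln m.+2%:R))
    = expR (zeta / 2 * (3 + ln m.+1%:R)) * expR (zeta / 2 * (ln m.+2%:R - ln m.+1%:R)).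
  by rewrite -expRD; congr expR; ring.
by rewrite mulrACA mulrA.
Qed.

(** The Markov inequality for (1 + zeta)^c, where c is the number of cycles:
    weighing orientations by ((1 + zeta) / 2)^c gives the product on the left of
    [prod_ratio_le], and the number of graphs is at least 2/5 times the product
    on the right. *)
Lemma many_cycles_le T (zeta : R) : (3 <= n)%N -> 0 <= zeta ->
  \sum_(p | no_short_cycle [set: V] p && (T < #|porbits p|)%N) 2^-1 ^+ #|porbits p|
    <= many_cycles_bound n T zeta * #|regular_graphs V 2|%:R.
Proof.
move=> n3 z0; have z1 : 1 <= 1 + zeta by rewrite lerDl.
have zp : 0 < 1 + zeta by apply: lt_le_trans z1.
have pT : 0 < (1 + zeta) ^+ T.+1 by apply: exprn_gt0.
have y0 : (1 + zeta) / 2 != 0 by rewrite mulf_neq0 ?invr_neq0 ?gt_eqF.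
apply: (@le_trans _ _ (\sum_(p : {perm V})
    ((1 + zeta) / 2) ^+ #|porbits p| / (1 + zeta) ^+ T.+1)).
  apply: (@le_trans _ _ (\sum_(p | no_short_cycle [set: V] p && (T < #|porbits p|)%N)
    ((1 + zeta) / 2) ^+ #|porbits p| / (1 + zeta) ^+ T.+1)).
    apply: ler_sum => p /andP[_ Tp]; rewrite ler_pdivlMr // exprMn mulrC.
    by rewrite ler_wpM2r ?exprn_ge0 ?invr_ge0 // ler_weXn2l.
  apply: ler_sum_subset => // p _.
  by rewrite divr_ge0 ?exprn_ge0 ?divr_ge0 // ltW.
rewrite -mulr_suml (sum_perm_porbits _ y0) -/n.
have := card_regular_graphs_lower n3.
have := @prod_ratio_le zeta n.-2 z0.
rewrite (@prednK n.-1) 1?(@prednK n); last by lia.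
  2: by lia.
rewrite /many_cycles_bound.
set P1 := \prod_(i < n) _; set P2 := \prod_(i < n) _ => h1 h2.
rewrite [leRHS]mulrAC; apply: ler_wpM2r; first by rewrite invr_ge0 ltW.
have le_e : expR (zeta / 2 * (3 + ln n.-1%:R)) <= expR (zeta / 2 * (3 + ln n%:R)).
  rewrite ler_expR ler_wpM2l ?divr_ge0 // lerD2l ler_ln ?posrE ?ltr0n ?ler_nat ?leq_pred //.
    by lia.
  by lia.
have P20 : 0 <= P2 by apply: prodr_ge0 => i _; rewrite addr_ge0 // invr_ge0.
apply: le_trans h1 _; apply: le_trans (ler_wpM2r P20 le_e) _.
have E0 := expR_ge0 (zeta / 2 * (3 + ln n%:R)).
apply: (@le_trans _ _ (5 / 2 * expR (zeta / 2 * (3 + ln n%:R)) * (2 / 5 * P2))).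
  have e5 (a b : R) : a * b = 5 / 2 * a * (2 / 5 * b) by field.
  by rewrite [leLHS]e5.
by rewrite ler_wpM2l // mulr_ge0 // divr_ge0.
Qed.

(** Conjugation by s preserves the cycle type and the weight of p, so averaging
    over s inside the sum over p leaves that sum unchanged; for every p with at
    most T cycles the average is bounded by [not_hamiltonian_le]. *)
Lemma hamiltonian_prob_lower G (T K k y0 : nat) (lam zeta : R) :
    (0 < T)%N -> (forall v, (k < degree G v)%N) -> (8 * K <= k)%N ->
    (2 * (T * K) * T <= n)%N -> (6 <= n)%N -> (0 < y0)%N -> 0 <= lam < 1 ->
    0 <= zeta ->
  1 - (many_cycles_bound n T zeta
       + T%:R * (short_fail n T K k y0 lam
                 + 3 * (1 - k%:R / (2 * n%:R)) ^+ K./2))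
  <= unif_prob R (regular_graphs V 2) [set F | hamiltonian (gunion G F)].
Proof.
move=> T0 degk Kk nbig n6 y00 lam01 z0.
have n3 : (3 <= n)%N by apply: leq_trans n6.
set B := T%:R * _; set Reg := regular_graphs V 2.
pose r : R := #|Reg|%:R.
have r0 : 0 < r.
  apply: lt_le_trans (card_regular_graphs_lower n3).
  apply: mulr_gt0; first by rewrite divr_gt0.
  by apply: prodr_gt0 => i _; rewrite ltr_wpDr // invr_gt0.
pose bad F : R := (~~ hamiltonian (gunion G F))%:R.
have N0 : 0 < #|{perm V}|%:R :> R by rewrite ltr0n; apply/card_gt0P; exists 1%g.
pose few p := no_short_cycle [set: V] p && (#|porbits p| <= T)%N.
have rE : r = \sum_(p | no_short_cycle [set: V] p) 2^-1 ^+ #|porbits p|.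
  exact: card_regular_graphs.
have w0 p : 0 <= 2^-1 ^+ #|porbits p| :> R by rewrite exprn_ge0 // invr_ge0.
have B0 : 0 <= B.
  apply: mulr_ge0 => //; apply: addr_ge0; first exact: short_fail_ge0.
  rewrite mulr_ge0 // exprn_ge0 // one_minus_ratio_ge0 //.
  have [v _] : exists v : V, v \in V by apply/card_gt0P; apply: leq_trans n6.
  by apply: leq_trans (ltnW (degk v)) (max_card _).
have few_bad : \sum_(p | few p) 2^-1 ^+ #|porbits p| * bad (permgraph p) <= B * r.
  rewrite -(ler_pM2r N0).
  have -> : (\sum_(p | few p) 2^-1 ^+ #|porbits p| * bad (permgraph p))
        * #|{perm V}|%:R
      = \sum_(p | few p) 2^-1 ^+ #|porbits p|
          * \sum_(s : {perm V}) bad (permgraph (p ^ s)%g).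
    under [RHS]eq_bigr do rewrite mulr_sumr.
    rewrite [RHS]exchange_big /= mulr_natr -sumr_const; apply: eq_bigr => s _.
    rewrite [LHS](reindex_inj (@conjg_inj _ s)); apply: eq_big => p.
      by rewrite /few no_short_cycleJ card_porbitsJ.
    by rewrite card_porbitsJ.
  rewrite mulrAC rE mulr_sumr.
  apply: (@le_trans _ _ (\sum_(p | few p) B * #|{perm V}|%:R * 2^-1 ^+ #|porbits p|)).
    apply: ler_sum => p /andP[p3 pT]; rewrite mulrC ler_wpM2r //.
    exact: not_hamiltonian_le.
  apply: ler_sum_subset => p; first by case/andP.
  by move=> _; apply: mulr_ge0 => //; apply: mulr_ge0 => //; apply: ltW.
have many_bad : \sum_(p | no_short_cycle [set: V] p && (T < #|porbits p|)%N)
    2^-1 ^+ #|porbits p| * bad (permgraph p) <= many_cycles_bound n T zeta * r.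
  apply: le_trans (many_cycles_le T n3 z0); apply: ler_sum => p _.
  by rewrite ler_piMr // /bad lern1 leq_b1.
have bad_le : \sum_(F in Reg) bad F <= (many_cycles_bound n T zeta + B) * r.
  rewrite sum_regular_graphs (bigID (fun p => #|porbits p| <= T)%N) /= addrC mulrDl.
  apply: lerD => //; apply: le_trans many_bad.
  by apply: le_of_eq; apply: eq_bigl => p; rewrite -ltnNge.
rewrite /unif_prob -/Reg -/r ler_pdivlMr // mulrBl mul1r lerBlDr.
apply: le_trans (lerD (lexx _) bad_le).
rewrite /r -(cardsID [set F | hamiltonian (gunion G F)] Reg) natrD lerD2l.
rewrite -sum1_card natr_sum big_mkcond [leRHS]big_mkcond /=; apply: ler_sum => F _.
rewrite in_setD in_set /bad; case: (F \in Reg); rewrite ?andbF //=.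
by case: (hamiltonian _).
Qed.

End FailureProbability.

(** * Choice of parameters and asymptotics *)

Lemma half_eighth_ge a : (80 <= a)%N -> (a <= (a %/ 8)./2 * 32)%N.
Proof.
move=> a80; rewrite -divn2 -divnMA.
by have := divn_eq a 16; have := ltn_pmod a (isT : 0 < 16)%N; lia.
Qed.

Section Asymptotics.
Variable R : realType.

Lemma le_expR_div (a x : R) : 0 < a -> x <= expR (a * x) / a.
Proof.
move=> a0; rewrite ler_pdivlMr // mulrC.
by apply: le_trans (expR_ge1Dx _); rewrite lerDr.
Qed.

Lemma expr1D_inv_le (z : R) m : 0 <= z ->
  ((1 + z) ^+ m)^-1 <= expR (- ((z - z ^+ 2) * m%:R)).
Proof.
move=> z0; have z1 : 0 < 1 + z by rewrite ltr_wpDr.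
rewrite -mulNr expRM_natr -exprVn; apply: lerXn2r; rewrite ?nnegrE ?expR_ge0 //.
  by rewrite invr_ge0 ltW.
apply: le_trans (expR_ge1Dx _); rewrite -[leLHS]mul1r ler_pdivrMr //.
have : 0 <= z ^+ 3 by rewrite exprn_ge0.
by move=> z3; rewrite -subr_ge0; have -> : (1 + - (z - z ^+ 2)) * (1 + z) - 1 = z ^+ 3 by ring.
Qed.

Lemma expr1B_inv_le (a : R) m : 0 <= a <= 1 / 8 ->
  ((1 - a) ^+ m)^-1 <= expR ((a + 8 / 7 * a ^+ 2) * m%:R).
Proof.
move=> /andP[a0 a8]; have a1 : 0 < 1 - a by lra.
rewrite expRM_natr -exprVn; apply: lerXn2r; rewrite ?nnegrE ?expR_ge0 //.
  by rewrite invr_ge0 ltW.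
apply: le_trans (expR_ge1Dx _); rewrite -[leLHS]mul1r ler_pdivrMr //.
have : 0 <= a ^+ 2 * (1 - 8 * a) by rewrite mulr_ge0 ?exprn_ge0 //; lra.
move=> h; rewrite -subr_ge0.
have -> : (1 + (a + 8 / 7 * a ^+ 2)) * (1 - a) - 1 = a ^+ 2 * (1 - 8 * a) / 7 by field.
by rewrite divr_ge0.
Qed.

Lemma expr1B_le (q : R) m : q <= 1 -> (1 - q) ^+ m <= expR (- (q * m%:R)).
Proof.
move=> q1; rewrite -mulNr expRM_natr; apply: lerXn2r; rewrite ?nnegrE ?expR_ge0 //.
  by rewrite subr_ge0.
exact: expR_ge1Dx.
Qed.

Variables (e : R) (n : nat).
Hypothesis e01 : 0 < e <= 1.
Let x : R := n%:R.
Let l : R := ln x.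
Hypothesis x_exp : expR 4 <= x.
Hypothesis x_eps : 6400 / e ^+ 2 <= x.
Hypothesis x_big : 10 ^+ 9 <= x.

(** The parameters for order n, where e stands for the minimum of eps and 1.
    Subtracting one from the degree in [link_degree] leaves room for deleting one
    vertex from a neighbourhood. *)
Definition target_degree : R := (1 + e) * Num.sqrt (x * l / 2).
Definition link_degree := (Num.truncn target_degree).-1.
Definition cycle_bound := Num.truncn ((1 / 2 + e / 8) * l).
Definition block_size := (link_degree %/ 8)%N.
Definition defect_bound := Num.truncn (e / 40 * link_degree%:R).

Let k := link_degree.
Let T := cycle_bound.
Let K := block_size.
Let y0 := defect_bound.

Let e0 : 0 < e. Proof. by case/andP: e01. Qed.
Let e1 : e <= 1. Proof. by case/andP: e01. Qed.
Let x0 : 0 < x. Proof. by apply: lt_le_trans x_exp; apply: expR_gt0. Qed.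
Let xE : expR l = x. Proof. by rewrite lnK // posrE. Qed.
Let l4 : 4 <= l. Proof. by rewrite -ler_expR xE. Qed.

Let xl : 4 * x <= x * l.
Proof. by rewrite mulrC ler_pM2l. Qed.

Let dd : target_degree ^+ 2 = (1 + e) ^+ 2 * (x * l / 2).
Proof.
rewrite exprMn sqr_sqrtr // divr_ge0 // mulr_ge0 ?ltW //.
by apply: lt_le_trans l4.
Qed.

Let d0 : 0 <= target_degree.
Proof. by rewrite mulr_ge0 ?sqrtr_ge0 // addr_ge0 // ltW. Qed.

Let d_big : 1 <= target_degree.
Proof.
rewrite -(ler_pXn2r (n := 2)) ?nnegrE // expr1n dd.
have : 1 <= (1 + e) ^+ 2 by rewrite exprn_ege1 // lerDl ltW.
have : 1 <= x * l / 2.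
  by move: xl x_big; lra.
by move=> h1 h2; apply: mulr_ege1.
Qed.

Let k_le : k%:R <= target_degree - 1.
Proof.
have := truncn_le target_degree; rewrite d0 => /idP h.
have t1 : (1 <= Num.truncn target_degree)%N by rewrite truncn_ge_nat.
by rewrite /k /link_degree -subn1 natrB // lerD2r.
Qed.

Let k_ge : target_degree - 2 <= k%:R.
Proof.
have := truncnS_gt target_degree; rewrite -natr1 => h.
have t1 : (1 <= Num.truncn target_degree)%N by rewrite truncn_ge_nat.
by rewrite /k /link_degree -subn1 natrB //; lra.
Qed.

Let k_up : k%:R ^+ 2 <= 2 * x * l.
Proof.
have h : k%:R <= target_degree by apply: le_trans k_le _; rewrite gerBl.
apply: (@le_trans _ _ (target_degree ^+ 2)); first by rewrite ler_pXn2r ?nnegrE.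
rewrite dd; have : (1 + e) ^+ 2 <= 2 ^+ 2.
  by rewrite ler_pXn2r ?nnegrE //; move: e0 e1; lra.
have : 0 <= x * l / 2 by move: xl x0; lra.
by move=> h1 h2; have := ler_wpM2r h1 h2; lra.
Qed.

Let k_low : (1 + e) * (x * l / 2) <= k%:R ^+ 2.
Proof.
have w0 : 0 <= x * l / 2 by move: xl x0; lra.
have d2 : 0 <= target_degree - 2.
  rewrite subr_ge0 -(ler_pXn2r (n := 2)) ?nnegrE // dd.
  have : 1 <= (1 + e) ^+ 2 by rewrite exprn_ege1 // lerDl ltW.
  move=> h; have := ler_wpM2r w0 h; move: xl x_big; lra.
apply: (@le_trans _ _ ((target_degree - 2) ^+ 2)); last by rewrite ler_pXn2r ?nnegrE.
have dle : target_degree <= e * (x * l / 2) / 4.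
  have pos : 0 <= e * (x * l / 2) / 4 by rewrite divr_ge0 // mulr_ge0 // ltW.
  rewrite -(ler_pXn2r (n := 2)) ?nnegrE // dd.
  have h4 : (1 + e) ^+ 2 <= 4 by rewrite expr2; move: e0 e1; nra.
  apply: (@le_trans _ _ (4 * (x * l / 2))); first by rewrite ler_wpM2r.
  have -> : (e * (x * l / 2) / 4) ^+ 2 = (e ^+ 2 * (x * l / 2) / 16) * (x * l / 2) by field.
  rewrite ler_wpM2r // ler_pdivlMr //.
  have : 6400 <= x * e ^+ 2 by rewrite -ler_pdivrMr // exprn_gt0.
  move=> h; apply: (@le_trans _ _ (x * e ^+ 2)); first by lra.
  have -> : e ^+ 2 * (x * l / 2) = x * e ^+ 2 * (l / 2) by field.
  by rewrite ler_peMr ?mulr_ge0 ?exprn_ge0 ?ltW //; move: l4; lra.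
have -> : (target_degree - 2) ^+ 2 = target_degree ^+ 2 - 4 * target_degree + 4 by ring.
rewrite dd; have : 0 <= e ^+ 2 * (x * l / 2) by rewrite mulr_ge0 // exprn_ge0 // ltW.
move: dle; move: (x * l / 2) target_degree => w d h1 h2; lra.
Qed.

Let k_sq : x <= k%:R ^+ 2.
Proof.
apply: le_trans k_low; have w0 : 0 <= x * l / 2 by move: xl x0; lra.
have : 0 <= e * (x * l / 2) by rewrite mulr_ge0 // ltW.
by move: xl x0; lra.
Qed.

Let k_eps : 80 <= e * k%:R.
Proof.
rewrite -(ler_pXn2r (n := 2)) ?nnegrE ?mulr_ge0 ?(ltW e0) // exprMn.
have : 6400 <= x * e ^+ 2 by rewrite -ler_pdivrMr // exprn_gt0.
have := ler_wpM2l (exprn_ge0 2 (ltW e0)) k_sq.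
by move: (e ^+ 2) (k%:R ^+ 2) => a b; lra.
Qed.

Let k80 : 80 <= k%:R :> R.
Proof. by apply: le_trans k_eps _; rewrite ler_piMl. Qed.

Let k_exp : expR (l / 2) <= k%:R.
Proof.
rewrite -(ler_pXn2r (n := 2)) ?nnegrE ?expR_ge0 // -expRM_natr.
by rewrite (_ : l / 2 * 2%:R = l) ?xE //; field.
Qed.

Let l0 : 0 <= l. Proof. by apply: le_trans l4. Qed.

Let T_le : T%:R <= (1 / 2 + e / 8) * l.
Proof. by rewrite truncn_le mulr_ge0 // addr_ge0 // divr_ge0 // ltW. Qed.

Let T_lt : (1 / 2 + e / 8) * l <= T.+1%:R.
Proof. by rewrite ltW // truncnS_gt. Qed.

Let T_l : T%:R <= l.
Proof.
by apply: le_trans T_le _; rewrite ler_piMl //; move: e1; lra.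
Qed.

Let y_low : e * k%:R / 80 <= y0%:R.
Proof.
have h : e * k%:R / 40 < y0%:R + 1 by rewrite natr1 mulrAC; apply: truncnS_gt.
by move: h k_eps; move: (e * k%:R) (y0%:R : R) => w y; lra.
Qed.

Let y_up : y0%:R <= e * k%:R / 40.
Proof.
by rewrite [leRHS]mulrAC truncn_le mulr_ge0 // divr_ge0 // ltW.
Qed.

Let K_up : K%:R <= k%:R / 8 :> R.
Proof. by rewrite ler_pdivlMr // -natrM ler_nat leq_divM. Qed.

Lemma cycle_bound_gt0 : (0 < T)%N.
Proof.
rewrite truncn_gt0; have : 0 <= e * l by rewrite mulr_ge0 // ltW.
by move: l4; lra.
Qed.

Lemma defect_bound_gt0 : (0 < y0)%N.
Proof. by rewrite -(ltr_nat R) (lt_le_trans _ y_low) // divr_gt0 // (lt_le_trans _ k_eps). Qed.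

Lemma block_size_le : (8 * K <= k)%N.
Proof. by rewrite mulnC leq_divM. Qed.

Lemma link_degree_lt (d : nat) : target_degree <= d%:R -> (k < d)%N.
Proof.
move=> h; rewrite -(ltr_nat R); apply: le_lt_trans k_le _.
by rewrite ltrBlDr (le_lt_trans h) // ltrDl.
Qed.

Lemma order_ge6 : (6 <= n)%N.
Proof. by rewrite -(ler_nat R); move: x_big; rewrite /x; lra. Qed.

Lemma blocks_fit : (2 * (T * K) * T <= n)%N.
Proof.
rewrite -(ler_nat R) -/x !natrM.
apply: (@le_trans _ _ (l ^+ 2 * k%:R / 4)).
  have : T%:R * T%:R <= l ^+ 2 by rewrite expr2 ler_pM.
  have KK : 0 <= K%:R :> R by [].
  have TT : 0 <= T%:R * T%:R :> R by rewrite mulr_ge0.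
  move=> h; apply: (@le_trans _ _ (2 * (T%:R * T%:R) * (k%:R / 8))).
    have -> : 2 * (T%:R * K%:R) * T%:R = 2 * (T%:R * T%:R) * K%:R :> R by ring.
    by rewrite ler_wpM2l // mulr_ge0.
  have -> : l ^+ 2 * k%:R / 4 = 2 * l ^+ 2 * (k%:R / 8) by field.
  by rewrite ler_wpM2r ?divr_ge0 // ler_wpM2l.
rewrite -(ler_pXn2r (n := 2)) ?nnegrE ?divr_ge0 ?mulr_ge0 ?exprn_ge0 ?(ltW x0) //.
have -> : (l ^+ 2 * k%:R / 4) ^+ 2 = l ^+ 4 * k%:R ^+ 2 / 16 by field.
apply: (@le_trans _ _ (l ^+ 4 * (2 * x * l) / 16)).
  by rewrite ler_wpM2r // ler_wpM2l // exprn_ge0.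
have -> : l ^+ 4 * (2 * x * l) / 16 = x * (l ^+ 5 / 8) by field.
rewrite [leRHS]expr2 ler_wpM2l ?(ltW x0) //.
have lx : l <= expR (10^-1 * l) / 10^-1 by apply: le_expR_div; rewrite invr_gt0.
have l5 : l ^+ 5 <= 10 ^+ 5 * expR (l / 2).
  apply: (@le_trans _ _ ((expR (10^-1 * l) / 10^-1) ^+ 5)).
    by apply: lerXn2r; rewrite ?nnegrE // (le_trans l0).
  rewrite exprMn invrK -expRM_natr mulrC.
  by have -> : 10^-1 * l * 5%:R = l / 2 by field.
have xh : expR (l / 2) ^+ 2 = x.
  by rewrite -expRM_natr (_ : l / 2 * 2%:R = l) ?xE //; field.
have h4 : 2 * 10 ^+ 4 <= expR (l / 2).
  rewrite -(ler_pXn2r (n := 2)) ?nnegrE ?expR_ge0 ?mulr_ge0 ?exprn_ge0 // xh.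
  by apply: le_trans x_big; rewrite exprMn -exprM !exprS expr0; lra.
rewrite ler_pdivrMr //; apply: le_trans l5 _; rewrite -xh expr2.
have -> : expR (l / 2) * expR (l / 2) * 8 = 8 * expR (l / 2) * expR (l / 2) by ring.
rewrite ler_wpM2r ?expR_ge0 //; move: h4; rewrite !exprS expr0; lra.
Qed.


(* The final exponent of n is - c; the tails of absorbers and of long cycles are
   of order n^(-2c), and n^c takes care of the number of cycles. *)
Let c : R := e ^+ 2 / 400.

Let c0 : 0 < c. Proof. by apply: divr_gt0; [apply: exprn_gt0|rewrite ltr0n]. Qed.

Let e2_le : e ^+ 2 <= 1.
Proof. by rewrite exprn_ile1 // ltW. Qed.

Let expR_le (a b : R) : a <= - (b * l) -> c <= b -> expR a <= expR (- (c * l)).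
Proof.
move=> ab cb; rewrite ler_expR (le_trans ab) // lerN2 ler_wpM2r //.
Qed.

(** With zeta = e / 8, the exponent of n is
    zeta/2 - (zeta - zeta^2)(1/2 + zeta) = - zeta^2 (1/2 - zeta). *)
Lemma many_cycles_tail :
  many_cycles_bound n T (e / 8) <= 5 / 2 * expR 1 * expR (- (c * l)).
Proof.
rewrite /many_cycles_bound -/x -/l; set z := e / 8.
have z0 : 0 <= z by rewrite divr_ge0 // ltW.
have z8 : z <= 1 / 8 by rewrite /z; move: e1; lra.
apply: le_trans (ler_wpM2l _ (expr1D_inv_le T.+1 z0)) _.
  by rewrite mulr_ge0 ?expR_ge0 // divr_ge0.
rewrite -[leLHS]mulrA -[leRHS]mulrA; apply: ler_wpM2l; first by rewrite divr_ge0.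
rewrite -!expRD ler_expR.
have h1 : (z - z ^+ 2) * ((1 / 2 + z) * l) <= (z - z ^+ 2) * T.+1%:R.
  by apply: ler_wpM2l T_lt; rewrite subr_ge0 expr2 ler_piMl //; move: z8; lra.
have h2 : z ^+ 2 * (3 / 8) * l <= z ^+ 2 * (1 / 2 - z) * l.
  apply: ler_wpM2r => //; apply: ler_wpM2l; first by rewrite exprn_ge0.
  by move: z8; lra.
have h3 : c * l <= z ^+ 2 * (3 / 8) * l.
  apply: ler_wpM2r => //; have -> : z ^+ 2 * (3 / 8) = 3 / 512 * e ^+ 2 by rewrite /z; field.
  by rewrite /c; move: (exprn_ge0 2 (ltW e0)); move: (e ^+ 2) => w; lra.
have h4 : z / 2 * 3 <= 1 by move: z8; lra.
have h5 : z / 2 * (3 + l) - (z - z ^+ 2) * ((1 / 2 + z) * l)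
   = z / 2 * 3 - z ^+ 2 * (1 / 2 - z) * l by field.
move: h1 h2 h3 h4 h5; move: (c * l) ((z - z ^+ 2) * T.+1%:R).
move: ((z - z ^+ 2) * ((1 / 2 + z) * l)) (z / 2 * (3 + l)) (z / 2 * 3).
by move: (z ^+ 2 * (3 / 8) * l) (z ^+ 2 * (1 / 2 - z) * l) => *; lra.
Qed.

Lemma defect_tail :
  T%:R * ((4 + 2 * (2 * k%:R + 2) ^+ 2 / n%:R + 32 * k%:R * (T * K)%:R / n%:R) / y0%:R)
    <= 76 * 80 * 12 ^+ 3 / e * expR (- (c * l)).
Proof.
have num0 : 0 <= 4 + 2 * (2 * k%:R + 2) ^+ 2 / n%:R + 32 * k%:R * (T * K)%:R / n%:R :> R.
  by [].
rewrite -/x in num0 *.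
have k0 : 0 < k%:R :> R by apply: lt_le_trans k80.
have ek0 : 0 < e * k%:R by rewrite mulr_gt0.
have y00 : 0 < y0%:R :> R by apply: lt_le_trans y_low; rewrite divr_gt0.
have l1 : 1 <= l by apply: le_trans l4; rewrite ler1n.
have xi : 0 < x^-1 by rewrite invr_gt0.
have kx : k%:R ^+ 2 / x <= 2 * l.
  by rewrite ler_pdivrMr //; apply: le_trans k_up _; rewrite mulrAC.
have n1 : 2 * (2 * k%:R + 2) ^+ 2 / x <= 64 * l.
  apply: (@le_trans _ _ (32 * (k%:R ^+ 2 / x))); last by move: kx; lra.
  rewrite [leRHS]mulrA ler_pM2r //.
  have : (2 * k%:R + 2) ^+ 2 <= (4 * k%:R) ^+ 2 :> R.
    by rewrite ler_pXn2r ?nnegrE ?addr_ge0 ?mulr_ge0 //; move: k80; lra.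
  by rewrite exprMn; lra.
have n2 : 32 * k%:R * (T * K)%:R / x <= 8 * l ^+ 2.
  rewrite natrM.
  apply: (@le_trans _ _ (4 * T%:R * (k%:R ^+ 2 / x))).
    rewrite [leRHS]mulrA ler_pM2r //.
    apply: (@le_trans _ _ (32 * k%:R * (T%:R * (k%:R / 8)))).
      by apply: ler_wpM2l; [rewrite mulr_ge0|apply: ler_wpM2l].
    by apply: le_of_eq; field.
  apply: (@le_trans _ _ (4 * l * (2 * l))); last first.
    by apply: le_of_eq; ring.
  have T4 : 4 * T%:R <= 4 * l by rewrite ler_wpM2l.
  apply: ler_pM T4 kx => //; exact: divr_ge0.
have num : 4 + 2 * (2 * k%:R + 2) ^+ 2 / x + 32 * k%:R * (T * K)%:R / x <= 76 * l ^+ 2.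
  have : l <= l ^+ 2 by rewrite expr2 ler_peMl.
  by move: n1 n2 l1; lra.
have yi : y0%:R^-1 <= 80 / (e * k%:R).
  rewrite -[leRHS]invrK lef_pV2 ?posrE ?invr_gt0 ?divr_gt0 //.
  by rewrite invf_div.
apply: (@le_trans _ _ (l * (76 * l ^+ 2 * (80 / (e * k%:R))))).
  apply: ler_pM => //; first by rewrite divr_ge0.
  by apply: ler_pM => //; rewrite invr_ge0 ltW.
have l3 : l ^+ 3 <= 12 ^+ 3 * expR (l / 4).
  have lx : l <= expR (12^-1 * l) / 12^-1 by apply: le_expR_div; rewrite invr_gt0.
  apply: (@le_trans _ _ ((expR (12^-1 * l) / 12^-1) ^+ 3)).
    by apply: lerXn2r; rewrite ?nnegrE // (le_trans l0).
  rewrite exprMn invrK -expRM_natr mulrC.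
  by rewrite (_ : 12^-1 * l * 3%:R = l / 4) //; field.
have ki : k%:R^-1 <= expR (- (l / 2)).
  by rewrite expRN lef_pV2 ?posrE ?expR_gt0.
have -> : l * (76 * l ^+ 2 * (80 / (e * k%:R))) = 76 * 80 / e * (l ^+ 3 * k%:R^-1).
  by field; rewrite !gt_eqF.
have -> : 76 * 80 * 12 ^+ 3 / e * expR (- (c * l))
    = 76 * 80 / e * (12 ^+ 3 * expR (- (c * l))) by field; rewrite gt_eqF.
apply: ler_wpM2l; first by rewrite divr_ge0 // ltW.
apply: (@le_trans _ _ (12 ^+ 3 * expR (l / 4) * expR (- (l / 2)))).
  by apply: ler_pM; rewrite ?exprn_ge0 ?invr_ge0.
rewrite -mulrA -expRD; apply: ler_wpM2l; first by rewrite exprn_ge0.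
apply: (@expR_le _ (1 / 4)); first by lra.
by rewrite /c; move: e2_le; lra.
Qed.

(** With lam = e / 8, the mean k^2 / n of the number of absorbers is at least
    (1 + e) l / 2 while T is at most (1 + e/4) l / 2, so the exponent is negative
    of order e^2 l: the leading terms are - lam (1 + e) l / 2 and
    lam (1 + e/4) l / 2, and the corrections do not outweigh their sum. *)
Lemma absorber_tail :
  expR (- (e / 8 * (1 - e / 8 / 2)) * (k%:R ^+ 2 - k%:R - 4 * k%:R * y0%:R) / n%:R)
    / (1 - e / 8) ^+ T <= expR (- (2 * c * l)).
Proof.
rewrite -/x; have l8 : 0 <= e / 8 <= 1 / 8 by move: e0 e1; lra.
apply: le_trans (ler_wpM2l (expR_ge0 _) (expr1B_inv_le T l8)) _.
rewrite -expRD ler_expR.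
have k0 : 0 < k%:R :> R by apply: lt_le_trans k80.
have w1 : k%:R <= e / 40 * k%:R ^+ 2 :> R.
  rewrite expr2 mulrA ler_peMl ?(ltW k0) //; move: k_eps; lra.
have w2 : 4 * k%:R * y0%:R <= e / 10 * k%:R ^+ 2.
  apply: (@le_trans _ _ (4 * k%:R * (e * k%:R / 40))).
    by apply: ler_wpM2l y_up; rewrite mulr_ge0.
  by apply: le_of_eq; field.
have w3 : (1 - e / 8) * k%:R ^+ 2 <= k%:R ^+ 2 - k%:R - 4 * k%:R * y0%:R.
  by move: w1 w2; lra.
have w4 : (1 - e / 8) * ((1 + e) * (l / 2))
    <= (k%:R ^+ 2 - k%:R - 4 * k%:R * y0%:R) / x.
  rewrite ler_pdivlMr //; apply: le_trans w3.
  rewrite -!mulrA; apply: ler_wpM2l; first by move: e1; lra.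
  by apply: le_trans k_low; apply: le_of_eq; ring.
have w5 : e / 8 * (1 - e / 8 / 2) * ((1 - e / 8) * ((1 + e) * (l / 2)))
   <= e / 8 * (1 - e / 8 / 2) * ((k%:R ^+ 2 - k%:R - 4 * k%:R * y0%:R) / x).
  by apply: ler_wpM2l w4; rewrite mulr_ge0 //; move: e0 e1; lra.
have w6 : (e / 8 + 8 / 7 * (e / 8) ^+ 2) * T%:R
    <= (e / 8 + 8 / 7 * (e / 8) ^+ 2) * ((1 / 2 + e / 8) * l).
  have [l8a _] := andP l8; apply: ler_wpM2l T_le.
  by apply: addr_ge0 => //; apply: mulr_ge0; [rewrite divr_ge0|rewrite exprn_ge0].
have w7 : (e / 8 + 8 / 7 * (e / 8) ^+ 2) * (1 / 2 + e / 8) + 2 * c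
    <= e / 8 * (1 - e / 8 / 2) * ((1 - e / 8) * ((1 + e) / 2)).
  have h2 : 0 <= e ^+ 2 by rewrite exprn_ge0 // ltW.
  have h3 : 0 <= e ^+ 2 * (1 - e) by rewrite mulr_ge0 // subr_ge0.
  have h4 : 0 <= e ^+ 4 by rewrite exprn_ge0 // ltW.
  by rewrite /c; lra.
have w8 := ler_wpM2r l0 w7.
rewrite !mulNr -[X in - X]mulrA.
have w9 : e / 8 * (1 - e / 8 / 2) * ((1 - e / 8) * ((1 + e) * (l / 2)))
    = e / 8 * (1 - e / 8 / 2) * ((1 - e / 8) * ((1 + e) / 2)) * l by field.
have w10 : ((e / 8 + 8 / 7 * (e / 8) ^+ 2) * (1 / 2 + e / 8) + 2 * c) * l
    = (e / 8 + 8 / 7 * (e / 8) ^+ 2) * ((1 / 2 + e / 8) * l) + 2 * c * l by ring.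
rewrite w9 in w5; rewrite w10 in w8.
have lin (a b u v w : R) : a <= b -> u <= v -> v + w <= a -> - b + u <= - w.
  by move=> *; lra.
exact: lin w5 w6 w8.
Qed.

Let k_le_x : k%:R <= x.
Proof.
rewrite -(ler_pXn2r (n := 2)) ?nnegrE ?(ltW x0) //; apply: le_trans k_up _.
have lx : l <= expR (2^-1 * l) / 2^-1 by apply: le_expR_div; rewrite invr_gt0.
have xh : expR (2^-1 * l) ^+ 2 = x.
  by rewrite -expRM_natr (_ : 2^-1 * l * 2%:R = l) ?xE //; field.
have h4 : 4 <= expR (2^-1 * l).
  rewrite -(ler_pXn2r (n := 2)) ?nnegrE ?expR_ge0 // xh.
  by apply: le_trans x_big; rewrite !exprS expr0; lra.
rewrite mulrAC mulrC expr2; apply: ler_wpM2l; first exact: ltW.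
apply: (@le_trans _ _ (4 * expR (2^-1 * l))); first by move: lx; rewrite invrK; lra.
by rewrite -xh expr2; apply: ler_wpM2r h4; apply: expR_ge0.
Qed.

Lemma long_tail : 3 * (1 - k%:R / (2 * n%:R)) ^+ K./2 <= 3 * expR (- (2 * c * l)).
Proof.
rewrite -/x; apply: ler_wpM2l => //.
have k0 : 0 < k%:R :> R by apply: lt_le_trans k80.
have kn : k%:R / (2 * x) <= 1.
  rewrite ler_pdivrMr ?mulr_gt0 // mul1r; apply: le_trans k_le_x _.
  by rewrite ler_peMl ?(ltW x0) // ler1n.
apply: le_trans (expr1B_le _ kn) _; rewrite ler_expR lerN2.
have K2 : k%:R / 32 <= K./2%:R :> R.
  rewrite ler_pdivrMr // -natrM ler_nat.
  by apply: half_eighth_ge; rewrite -(ler_nat R).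
apply: (@le_trans _ _ (k%:R / (2 * x) * (k%:R / 32))); last first.
  by apply: ler_wpM2l K2; rewrite divr_ge0 // mulr_ge0 // ltW.
have -> : k%:R / (2 * x) * (k%:R / 32) = k%:R ^+ 2 / (64 * x) by field; rewrite gt_eqF.
rewrite ler_pdivlMr ?mulr_gt0 //; apply: le_trans k_low.
have w0 : 0 <= x * l by rewrite mulr_ge0 // ltW.
have h1 : 0 <= (1 - e ^+ 2) * (x * l) by rewrite mulr_ge0 // subr_ge0.
have h2 : 0 <= e * (x * l) by rewrite mulr_ge0 // ltW.
by rewrite /c; lra.
Qed.

Definition failure_constant : R :=
  5 / 2 * expR 1 + 76 * 80 * 12 ^+ 3 / e + 4 / c.

Lemma failure_le :
  many_cycles_bound n T (e / 8)
  + T%:R * (short_fail n T K k y0 (e / 8) + 3 * (1 - k%:R / (2 * n%:R)) ^+ K./2)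
  <= failure_constant * expR (- (c * l)).
Proof.
rewrite /failure_constant [leRHS]mulrDl [X in _ <= X + _]mulrDl -[leRHS]addrA.
apply: lerD; first exact: many_cycles_tail.
rewrite /short_fail -[X in T%:R * X]addrA [leLHS]mulrDr.
apply: lerD; first exact: defect_tail.
have le1 : T%:R <= expR (c * l) / c by apply: le_trans T_l _; apply: le_expR_div.
have e2c : expR (- (2 * c * l)) = expR (- (c * l)) * expR (- (c * l)).
  by rewrite -expRD; congr expR; ring.
apply: (@le_trans _ _ (expR (c * l) / c * (4 * expR (- (2 * c * l))))).
  have l8 : 0 <= 1 - e / 8 by move: e1; lra.
  have h4 : 1 + 3 = 4 :> R by ring.
  have h := lerD absorber_tail long_tail.
  apply: ler_pM => //.
    apply: addr_ge0; first by apply: divr_ge0; [apply: expR_ge0|apply: exprn_ge0].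
    apply: mulr_ge0 => //; apply: exprn_ge0; apply: one_minus_ratio_ge0.
    by rewrite -(ler_nat R); apply: k_le_x.
  by apply: le_trans h _; rewrite -[X in X + _ <= _]mul1r -mulrDl h4.
rewrite e2c; apply: le_of_eq.
have -> : expR (c * l) / c * (4 * (expR (- (c * l)) * expR (- (c * l))))
   = expR (c * l) * expR (- (c * l)) * (4 / c * expR (- (c * l))) by ring.
by rewrite expRxMexpNx_1 mul1r.
Qed.

End Asymptotics.

(** * The theorem *)

Local Open Scope classical_set_scope.
Local Open Scope ring_scope.

Lemma cvg_expR_ln (R : realType) (C c : R) : 0 < c ->
  (fun n : nat => C * expR (- (c * ln n%:R))) @ \oo --> (0 : R).
Proof.
move=> c0; rewrite -[X in _ --> X](mulr0 C); apply: cvgMr.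
apply/cvgrPdist_lt => r r0; near=> n; rewrite sub0r normrN ger0_norm ?expR_ge0 //.
have n0 : expR (- (ln r / c)) < n%:R by near: n; apply: nbhs_infty_gtr.
have np : 0 < n%:R :> R by apply: lt_trans n0; apply: expR_gt0.
rewrite -[ltRHS](@lnK _ r) ?posrE // ltr_expR.
have : - (ln r / c) < ln n%:R by rewrite -ltr_expR lnK ?posrE.
by rewrite -mulNr ltr_pdivrMr // => h; rewrite ltrNl mulrC.
Unshelve. all: by end_near. Qed.

Lemma min_degree_le (V : finType) (G : sgraph V) v : (min_degree G <= degree G v)%N.
Proof.
rewrite /min_degree; have := mem_index_enum v.
elim: (index_enum V) => // w r IH; rewrite inE big_cons => /orP[/eqP->|/IH h].
  exact: geq_minl.
exact: leq_trans (geq_minr _ _) h.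
Qed.

Theorem theorem1p1 (R : realType) (eps : R) (heps : 0 < eps) :
  exists (n0 : nat) (delta : nat -> R),
    delta @ \oo --> (0 : R) /\
    forall (n : nat) (V : finType) (G : sgraph V),
      (n0 < n)%N -> #|V| = n ->
      (1 + eps) * Num.sqrt (n%:R * ln n%:R / 2) <= (min_degree G)%:R ->
      1 - delta n <=
        unif_prob R (regular_graphs V 2)
          [set F | hamiltonian (gunion G F)]%SET.
Proof.
pose e := Num.min eps 1.
have e0 : 0 < e by rewrite lt_min heps ltr01.
have e01 : 0 < e <= 1 by rewrite e0 ge_min lexx orbT.
have e20 : 0 < e ^+ 2 by apply: exprn_gt0.
exists (Num.truncn (expR 4 + 6400 / e ^+ 2 + 10 ^+ 9)).
exists (fun n => failure_constant e * expR (- (e ^+ 2 / 400 * ln n%:R))).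
split; first by apply: cvg_expR_ln; apply: divr_gt0; rewrite ?ltr0n.
move=> n V G n_big Vn degG.
have t1 : 0 <= expR 4 :> R by apply: expR_ge0.
have t2 : 0 <= 6400 / e ^+ 2 by apply: divr_ge0; [rewrite ler0n|apply: ltW].
have t3 : 0 <= 10 ^+ 9 :> R by apply: exprn_ge0.
have x_big : expR 4 + 6400 / e ^+ 2 + 10 ^+ 9 < n%:R.
  by rewrite -truncn_lt_nat ?addr_ge0 ?t1 ?t2 ?t3.
have x1 : expR 4 <= n%:R :> R.
  by apply: (le_trans _ (ltW x_big)); rewrite -addrA lerDl addr_ge0.
have x2 : 6400 / e ^+ 2 <= n%:R.
  by apply: (le_trans _ (ltW x_big)); rewrite addrAC lerDr addr_ge0.
have x3 : 10 ^+ 9 <= n%:R :> R.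
  by apply: (le_trans _ (ltW x_big)); rewrite lerDr addr_ge0.
have deg v : target_degree e n <= (degree G v)%:R.
  apply: (@le_trans _ _ (min_degree G)%:R); last by rewrite ler_nat min_degree_le.
  apply: le_trans degG; rewrite /target_degree ler_wpM2r ?sqrtr_ge0 // lerD2l.
  by rewrite ge_min lexx.
apply: (le_trans (y := 1 - (many_cycles_bound n (cycle_bound e n) (e / 8)
  + (cycle_bound e n)%:R * (short_fail n (cycle_bound e n) (block_size e n)
       (link_degree e n) (defect_bound e n) (e / 8)
     + 3 * (1 - (link_degree e n)%:R / (2 * n%:R)) ^+ (block_size e n)./2)))).
  by rewrite lerD2l lerN2; apply: failure_le.
rewrite -Vn in x1 x2 x3 deg *.
have e81 : e / 8 < 1.
  by rewrite ltr_pdivrMr // mul1r; case/andP: e01 => _ h; apply: le_lt_trans h _; rewrite ltr1n.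
apply: hamiltonian_prob_lower.
- exact: cycle_bound_gt0.
- by move=> v; apply: link_degree_lt.
- exact: block_size_le.
- exact: blocks_fit.
- exact: (order_ge6 x3).
- exact: defect_bound_gt0.
- by rewrite e81 divr_ge0 // ltW.
- by rewrite divr_ge0 // ltW.
Qed.
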